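(* Let $X$ be an additive product graph, i.e. $X=A_1\boxplus\cdots\boxplus A_c$ for some simple undirected graphs $A_1,\dots,A_c$ on a common finite vertex set $[n]$ such that the sum graph $A_1+\cdots+A_c$ is connected and each $\underline{A}_j$ is nonempty and connected. Suppose that $\chi(X)>\rho(X)$. Then $X$ is $k$-quasi-Ramanujan for some integer $k\ge 1$; that is, for some $k \geq 1$ there are infinitely many (pairwise non-isomorphic) graphs $G\in\mathsf{FinQuo}(X)$ with $\lambda_{k+1}(G)\le\rho(X)$.
   Context: Graphs are connected, undirected, with at most countably many vertices and uniformly bounded degrees; parallel edges and self-loops are allowed unless stated otherwise. The eigenvalues of a finite graph $G$ are those of its adjacency matrix, listed as $\lambda_1(G)\ge\lambda_2(G)\ge\cdots$ with multiplicity. Spectral radius: $\rho(X)=\limsup_{t\to\infty}(c_{uv}^{(t)})^{1/t}$, where $c_{uv}^{(t)}$ is the number of walks of length $t$ in $X$ from $u$ to $v$ (independent of the choice of $u,v$). It equals the operator norm of the adjacency operator on $\ell^2(V(X))$. Covers: $X_1=(V_1,E_1)$ covers $X_2=(V_2,E_2)$ (and $X_2$ is a quotient of $X_1$) if there are surjections $f_V:V_1\to V_2$, $f_E:E_1\to E_2$ with $f_E(\{u,v\})=\{f_V(u),f_V(v)\}$ (an edge between those vertices), such that for each $u \in V_1$, $f_E$ bijects the edges incident to $u$ with the edges incident to $f_V(u)$. $\mathsf{FinQuo}(X)$ is the family of finite (connected) graphs, up to isomorphism, covered by $X$. All graphs in $\mathsf{FinQuo}(X)$ have the same spectral radius (largest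 eigenvalue), denoted $\chi(X)$ when $\mathsf{FinQuo}(X)\neq\emptyset$. Additive product: let $A_1,\dots,A_c$ (''atoms'') be simple undirected graphs (identified with their adjacency matrices) on common vertex set $[n]$. The sum graph $A_1+\cdots+A_c$ is the multigraph on $[n]$ whose adjacency matrix is the sum of the adjacency matrices. $\underline{A}_j$ denotes $A_j$ with isolated vertices removed. Assume the sum graph is connected and each $\underline{A}_j$ is nonempty and connected. Fix $v_1\in[n]$. The additive product $A_1\boxplus\cdots\boxplus A_c$ is the graph $(V,E)$, where $V$ is the set of strings $v_1C_1v_2C_2\cdots v_kC_kv_{k+1}$, $k\ge0$, with $v_i\in[n]$, $C_i\in[c]$, $C_i\ne C_{i+1}$ for $i<k$, and $v_i\neq v_{i+1}$ both vertices of $\underline{A}_{C_i}$ for $i\le k$; and $E$ consists of all pairs of elements of $V$ of the following forms ($s$ a string in $V$): $\{sCu,sCv\}$ with $\{u,v\}$ an edge of $\underline{A}_C$; $\{sCu,sCuC'v\}$ with $\{u,v\}$ an edge of $\underline{A}_{C'}$; and $\{v_1,v_1Cv\}$ with $\{v_1,v\}$ an edge of $\underline{A}_C$. Up to isomorphism it does not depend on $v_1$. *)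

(* Defs.v *)
From HB Require Import structures.
From mathcomp Require Import all_boot all_order all_algebra.
From mathcomp Require Import finmap polyrcf.
From mathcomp Require Import all_classical all_reals all_analysis.

Set Implicit Arguments.
Unset Strict Implicit.
Unset Printing Implicit Defensive.

Import Order.TTheory GRing.Theory Num.Theory.

Local Open Scope classical_set_scope.
Local Open Scope ring_scope.

(* Undirected multigraphs: an edge is mapped to its set of endpoints, which is
   a singleton for a self-loop; parallel edges have the same [ends]. *)
Record mgraph := MGraph {
  vert : countType;
  edge : choiceType;
  ends : edge -> set vert;
  endsP : forall e, exists u v, ends e = [set u; v] }.

Record fingraph := FinGraph {
  fvert : finType;
  fedge : finType;
  fends : fedge -> set fvert;
  fendsP : forall e, exists u v, fends e = [set u; v] }.

Coercion mgraph_of_fin (G : fingraph) : mgraph := MGraph (@fendsP G).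

(* [walk u s v]: s lists the successive (edge, next vertex) steps of a walk
   from u to v. *)
Fixpoint walk (X : mgraph) (u : vert X) (s : seq (edge X * vert X))
    (v : vert X) : Prop :=
  if s is (e, w) :: s' then ends e = [set u; w] /\ walk w s' v else u = v.

Definition connected_graph (X : mgraph) : Prop :=
  (exists u : vert X, True) /\ forall u v : vert X, exists s, walk u s v.

(* A set of walks of given length is finite when degrees are bounded; on an
   infinite set [fset_set] would be empty. *)
Definition nwalks (X : mgraph) (t : nat) (u v : vert X) : nat :=
  #|` fset_set [set s | size s = t /\ walk u s v] |.

Definition walk_growth (R : realType) (X : mgraph) (u v : vert X) : \bar R :=
  limn_esup (fun t : nat => (((nwalks t u v)%:R `^ (t%:R^-1))%:E : \bar R)).

(* The common value of [walk_growth u v] over all vertices u, v of a connected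
   graph of bounded degree. *)
Definition rho (R : realType) (X : mgraph) : \bar R :=
  xget 0%E [set r | exists u v : vert X, r = walk_growth R u v].

Definition covers (X Y : mgraph) : Prop :=
  exists (fV : vert X -> vert Y) (fE : edge X -> edge Y),
    [/\ set_surj setT setT fV,
        set_surj setT setT fE,
        forall e, ends (fE e) = fV @` ends e
      & forall u, set_bij [set e | ends e u] [set e | ends e (fV u)] fE].

Definition iso_graph (X Y : mgraph) : Prop :=
  exists (fV : vert X -> vert Y) (fE : edge X -> edge Y),
    [/\ bijective fV, bijective fE & forall e, ends (fE e) = fV @` ends e].

Definition FinQuo (X : mgraph) (G : fingraph) : Prop :=
  connected_graph G /\ covers X G.

(* A self-loop counts once on the diagonal: the covering condition, which
   lists a loop once among the edges at its vertex, forces this convention. *)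
Definition adjmx (R : realType) (G : fingraph) : 'M[R]_(#|fvert G|) :=
  \matrix_(i, j)
    (#|[pred e : fedge G | `[< fends e = [set enum_val i; enum_val j] >]]|)%:R.

(* The real eigenvalues in nonincreasing order, with multiplicity; there are n
   of them when A is symmetric. *)
Definition eigenvalues (R : realType) (n : nat) (A : 'M[R]_n) : seq R :=
  sort >=%R
    (flatten [seq nseq (mup x (char_poly A)) x | x <- rootsR (char_poly A)]).

(* Numbered from 1. *)
Definition lambda (R : realType) (k : nat) (G : fingraph) : R :=
  (eigenvalues (adjmx R G))`_k.-1.

(* The common value of the largest eigenvalue over FinQuo X. *)
Definition chi (R : realType) (X : mgraph) : R :=
  xget 0 [set r | exists2 G, FinQuo X G & r = lambda R 1 G].

Definition quasi_ramanujan (R : realType) (k : nat) (X : mgraph) : Prop :=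
  exists G : nat -> fingraph,
    (forall i, [/\ FinQuo X (G i), (k.+1 <= #|fvert (G i)|)%N
                 & ((lambda R k.+1 (G i))%:E <= rho R X)%E]) /\
    (forall i j, i <> j -> ~ iso_graph (G i) (G j)).

Definition simple_edges (V : countType) (r : V -> V -> Prop) : set (set V) :=
  [set e | exists u v, r u v /\ e = [set u; v]].

Lemma simple_edgesP (V : countType) (r : V -> V -> Prop)
    (e : simple_edges r) : exists u v, val e = [set u; v].
Proof. by case: e => e /= /set_mem[u [v [_ ->]]]; exists u, v. Qed.

(* The relation r need not be given symmetrically. *)
Definition simple_graph (V : countType) (r : V -> V -> Prop) : mgraph :=
  MGraph (@simple_edgesP V r).

Section Atoms.
Variables (n c : nat) (A : 'I_c -> rel 'I_n).

Definition sum_edges : set ('I_c * set 'I_n) :=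
  [set p | simple_edges (A p.1) p.2].

Lemma sum_edgesP (p : sum_edges) : exists u v, (val p).2 = [set u; v].
Proof. by case: p => p /= /set_mem[u [v [_ ->]]]; exists u, v. Qed.

Definition sum_graph : mgraph := MGraph sum_edgesP.

Definition nonisolated (j : 'I_c) (u : 'I_n) : bool := [exists v, A j u v].

Definition underline (j : 'I_c) : mgraph :=
  @simple_graph {u : 'I_n | nonisolated j u} (fun u v => A j (val u) (val v)).

(* The string v_1 C_1 v_2 ... C_k v_{k+1} is encoded, v_1 being fixed, by the
   sequence (C_1, v_2), ..., (C_k, v_{k+1}).  In [valid prev u s], prev is the
   letter preceding u, if any. *)
Fixpoint valid (prev : option 'I_c) (u : 'I_n) (s : seq ('I_c * 'I_n)) : bool :=
  if s is (C, v) :: s' then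
    [&& prev != Some C, u != v, nonisolated C u, nonisolated C v
      & valid (Some C) v s']
  else true.

Variable v1 : 'I_n.

Inductive product_edge : seq ('I_c * 'I_n) -> seq ('I_c * 'I_n) -> Prop :=
| EdgeSibling s C u v : A C u v ->
    product_edge (rcons s (C, u)) (rcons s (C, v))
| EdgeChild s C u C' v : A C' u v ->
    product_edge (rcons s (C, u)) (rcons (rcons s (C, u)) (C', v))
| EdgeRoot C v : A C v1 v ->
    product_edge [::] [:: (C, v)].

Definition additive_product : mgraph :=
  @simple_graph {s | valid None v1 s}
    (fun s t => product_edge (val s) (val t)).

End Atoms.

(* Main.v *)
Require Import Defs.
From mathcomp Require Import all_boot all_order all_fingroup all_algebra.
From mathcomp Require Import finmap polyrcf complex ring.
From mathcomp Require Import all_classical all_reals all_analysis.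

Set Implicit Arguments.
Unset Strict Implicit.
Unset Printing Implicit Defensive.

Import Order.TTheory GRing.Theory Num.Theory.

Local Open Scope ring_scope.

(** Let [X] be the additive product, [r] its spectral radius, and [n] the number
    of vertices of the base graph.  The claim holds with [k = n]: the base graph
    has only [n] eigenvalues, and a tower of two-fold lifts is built in which
    every eigenvalue that is added is at most [r].

    A lift that is still a quotient of [X] is described by signs [q (C, v)], one
    for each atom [C] and vertex [v]: the edges of the atom [C] are multiplied by
    [q (C, v) * q (C, w)], so that copies of atoms lift to copies of atoms.  The
    eigenvalues added by the lift are those of the signed adjacency matrix
    ([atlas_charpoly_lift]), so a signing is needed whose characteristic
    polynomial is positive on the half-line above [r].

    Such a signing is found by conditional expectations ([sign_selection]).  The
    sum of the characteristic polynomials over all choices of some of the signs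
    is a stable polynomial ([signsum_stable]): as a polynomial in the diagonal
    variable of a vertex [u] it is affine, with a slope that does not see the
    signs at [u], so its root is the mean of the two roots obtained by fixing one
    of these signs, and a mean of points outside the upper half-plane is outside
    as well.  Stability makes the ratio of the sum to its minor at [u]
    increasing, hence if the sum of two such polynomials is positive above [r]
    then so is one of the two.

    It remains to see that the full sum over signings is positive above [r]
    ([signsum_minor_gt0]).  Expanding determinants along rows gives a recursion
    over simple cycles; averaging over the signs kills the cycles that use more
    than one atom, so the averaged recursion stays inside single atoms
    ([signsum_minor_rec], [signsum_path_rec]).  The recursion without signs
    holds in finite subgraphs of [X], to which all these cycles lift as distinct
    cycles.  Comparing the two recursions ([compare_ind]) bounds the ratios of
    successive averaged minors below by ratios of minors of [x - A] for finite
    subgraphs of [X], and the latter are positive for [x > r] because an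
    eigenvector would force too many walks ([adj_minor_gt0_of_rho]).

    The lifts may be disconnected.  Each component is a finite quotient of [X]
    ([comp_FinQuo]), so it has the same largest eigenvalue as any other one; what
    is used is that this eigenvalue exceeds [r] ([component_big_root]), which is
    where [chi X > rho X] enters: otherwise a positive function [h] with
    [A h <= y h], [r < y < chi X], would exist on the component, and pulling it
    back to [X] and pushing it down to another quotient would bound the largest
    eigenvalue there by [y].  As a lift has at most [n] eigenvalues above [r], it
    has at most [n] components, so one of them is large, and these components
    form the required family. *)

(** * Principal minors and cofactors *)

Section FinDet.
Variables (R : comNzRingType) (V : finType).
Implicit Types (M N : V -> V -> R) (S T : {set V}).

Definition fmx M : 'M[R]_#|V| := \matrix_(i, j) M (enum_val i) (enum_val j).
Definition fdet M : R := \det (fmx M).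

(** The submatrix on [S] is completed by an identity block, which keeps the
    index type fixed while [S] varies. *)
Definition pad S M : V -> V -> R :=
  fun a b => if (a \in S) && (b \in S) then M a b else (a == b)%:R.
Definition minor S M : R := fdet (pad S M).
Definition colrep M (v : V) (y : V -> R) : V -> V -> R :=
  fun a b => if b == v then y a else M a b.

(** The numerators in Cramer's rule for the submatrix on [S] and the right-hand
    side [y]. *)
Definition cramer S M (y : V -> R) (v : V) : R := minor S (colrep M v y).

Lemma eq_fdet M N : (forall a b, M a b = N a b) -> fdet M = fdet N.
Proof. by move=> e; congr (\det _); apply/matrixP=> i j; rewrite !mxE e. Qed.

Lemma eq_minor S M N :
  (forall a b, a \in S -> b \in S -> M a b = N a b) -> minor S M = minor S N.
Proof.
move=> e; apply: eq_fdet => a b; rewrite /pad.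
by case: (boolP (a \in S)) => //= aS; case: (boolP (b \in S)) => //= bS; rewrite e.
Qed.

Lemma eq_cramer S M N y y' v :
    (forall a b, a \in S -> b \in S -> M a b = N a b) ->
    (forall a, a \in S -> y a = y' a) ->
  cramer S M y v = cramer S N y' v.
Proof.
by move=> e e'; apply: eq_minor => a b aS bS; rewrite /colrep e // e'.
Qed.

Lemma minor0 M : minor finset.set0 M = 1.
Proof.
rewrite -[RHS](det1 _ #|V|); congr (\det _); apply/matrixP=> i j.
by rewrite !mxE /pad !inE /= (inj_eq enum_val_inj).
Qed.

Definition fcofactor M v w : R := cofactor (fmx M) (enum_rank v) (enum_rank w).

Lemma fdet_row M v : fdet M = \sum_w M v w * fcofactor M v w.
Proof.
rewrite /fdet (expand_det_row _ (enum_rank v)) (reindex enum_rank) /=; last first.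
  by apply: onW_bij; exists enum_val => ?; rewrite ?enum_valK ?enum_rankK.
by apply: eq_bigr => w _; rewrite mxE !enum_rankK.
Qed.

Lemma enum_val_lift_neq v i : enum_val (lift (enum_rank v) i) != v :> V.
Proof. by rewrite -(inj_eq enum_rank_inj) enum_valK eq_sym neq_lift. Qed.

Lemma eq_fcofactor M N v w :
    (forall a b, a != v -> b != w -> M a b = N a b) ->
  fcofactor M v w = fcofactor N v w.
Proof.
move=> e; rewrite /fcofactor /cofactor; congr (_ * \det _).
by apply/matrixP=> i j; rewrite !mxE e // enum_val_lift_neq.
Qed.

Lemma fdet_unit_row M v w : (forall b, M v b = (b == w)%:R) ->
  fdet M = fcofactor M v w.
Proof.
move=> e; rewrite (fdet_row M v) (bigD1 w) //= e eqxx mul1r big1 ?addr0 // => b.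
by move=> /negPf bw; rewrite e bw mul0r.
Qed.

Lemma fdet_swap M v w : v != w ->
  fdet (fun a b => M a (tperm v w b)) = - fdet M.
Proof.
move=> vw; rewrite /fdet.
have -> : fmx (fun a b => M a (tperm v w b)) =
    col_perm (tperm (enum_rank v) (enum_rank w)) (fmx M).
  apply/matrixP=> i j; rewrite !mxE; congr (M _ _); apply: enum_rank_inj.
  rewrite enum_valK -[in RHS](enum_valK j); set b := enum_val j.
  case: (tpermP v w b) => [->|->|/eqP bv /eqP bw].
  - by rewrite tpermL.
  - by rewrite tpermR.
  - by rewrite tpermD // (inj_eq enum_rank_inj) eq_sym.
rewrite col_permE det_mulmx det_perm odd_permV odd_tperm (inj_eq enum_rank_inj) vw.
by rewrite expr1 mulrN1.
Qed.

(** Laplace expansion along row [v].  The cofactor at [(v, w)] becomes a Cramer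
    numerator of the smaller set after exchanging the columns [v] and [w].
    Iterated, this expands determinants over the simple paths starting at [v]. *)
Lemma cramer_rec S M y v : v \in S ->
  cramer S M y v = y v * minor (S :\ v) M
    - \sum_(w in S :\ v) M v w * cramer (S :\ v) M y w.
Proof.
move=> vS; rewrite {1}/cramer {1}/minor (fdet_row _ v) (bigD1 v) //=.
congr (_ + _).
  rewrite {1}/pad vS /= /colrep eqxx; congr (_ * _); rewrite /minor.
  rewrite (@fdet_unit_row _ v v); last first.
    by move=> b; rewrite /pad !inE eqxx /= eq_sym.
  by apply: eq_fcofactor => a b av bv; rewrite /pad !inE av bv /= (negPf bv).
rewrite (bigID (mem (S :\ v))) /= addrC big1 ?add0r => [|w]; last first.
  rewrite !inE => /andP[wv]; rewrite wv /= => wS.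
  by rewrite /pad (negPf wS) andbF eq_sym (negPf wv) mul0r.
rewrite -sumrN [LHS](eq_bigl [in S :\ v]); last first.
  by move=> w; rewrite !inE andbA andbb.
apply: eq_bigr => w; rewrite !inE => /andP[wv wS].
rewrite {1}/pad vS wS /= {1}/colrep (negPf wv) -mulrN; congr (_ * _).
rewrite /cramer /minor.
pose N := pad (S :\ v) (colrep M w y).
rewrite -/N (_ : fdet N = fcofactor N v v); last first.
  by apply: fdet_unit_row => b; rewrite /N /pad !inE eqxx /= eq_sym.
pose U a b := if a == v then (b == w)%:R else pad S (colrep M v y) a b.
rewrite (_ : fcofactor _ v w = fdet U); last first.
  rewrite (@fdet_unit_row U v w) => [|b]; last by rewrite /U eqxx.
  by apply: eq_fcofactor => a b av bw; rewrite /U (negPf av).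
rewrite -[LHS]opprK -(@fdet_swap U v w) 1?eq_sym //; congr (- _).
rewrite (@fdet_unit_row _ v v) => [|b]; last first.
  by rewrite /U eqxx -[b == v](inj_eq (@perm_inj _ (tperm v w))) tpermL.
apply: eq_fcofactor => a b av bv; rewrite /U (negPf av) /N /pad /colrep !inE av bv /=.
case: (eqVneq b w) => [->|bw].
  rewrite tpermR vS wS eqxx; case: (boolP (a \in S)) => //= aS.
  by rewrite (negPf av) (_ : a == w = false) //; apply: contraNF aS => /eqP->.
by rewrite (_ : tperm v w b = b) ?(negPf bv) // tpermD // eq_sym.
Qed.

Lemma minor_rec S M v : v \in S ->
  minor S M = M v v * minor (S :\ v) M
    - \sum_(w in S :\ v) M v w * cramer (S :\ v) M (M^~ v) w.
Proof.
move=> vS; rewrite -(cramer_rec M (M^~ v) vS); apply: eq_minor => a b _ _.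
by rewrite /colrep; case: eqP => [->|].
Qed.

Lemma cramerE S M y u : u \in S ->
  \sum_(w in S) M u w * cramer S M y w = minor S M * y u.
Proof.
move=> uS.
have cE w : w \in S -> cramer S M y w =
    \sum_(a in S) y a * fcofactor (pad S M) a w.
  move=> wS; rewrite /cramer /minor /fdet -det_tr.
  rewrite (expand_det_row _ (enum_rank w)) (reindex enum_rank) /=; last first.
    by apply: onW_bij; exists enum_val => ?; rewrite ?enum_valK ?enum_rankK.
  rewrite (bigID (mem S)) /= [X in _ + X]big1 ?addr0 => [|a aS]; last first.
    rewrite !mxE !enum_rankK /pad (negPf aS) /=.
    by rewrite (_ : a == w = false) ?mul0r //; apply: contraNF aS => /eqP->.
  apply: eq_bigr => a aS; rewrite !mxE !enum_rankK /pad aS wS /= /colrep eqxx.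
  congr (_ * _); rewrite cofactor_tr /fcofactor /cofactor; congr (_ * \det _).
  apply/matrixP=> i j; rewrite !mxE.
  by rewrite (negPf (enum_val_lift_neq w j)).
under eq_bigr => w wS do rewrite cE // mulr_sumr.
rewrite exchange_big /=.
have adjE a : a \in S ->
    \sum_(w in S) M u w * fcofactor (pad S M) a w = (u == a)%:R * minor S M.
  move=> aS; have := mul_mx_adj (fmx (pad S M)).
  move=> /(congr1 (fun X : matrix R _ _ => X (enum_rank u) (enum_rank a))).
  rewrite !mxE (inj_eq enum_rank_inj) => adjua.
  rewrite mulr_natl /minor /fdet -adjua.
  rewrite [RHS](reindex enum_rank) /=; last first.
    by apply: onW_bij; exists enum_val => ?; rewrite ?enum_valK ?enum_rankK.
  rewrite [RHS](bigID (mem S)) /= [X in _ + X]big1 ?addr0 => [|w wS]; last first.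
    rewrite !mxE !enum_rankK /pad uS (negPf wS) /=.
    by rewrite (_ : u == w = false) ?mul0r //; apply: contraNF wS => /eqP<-.
  by apply: eq_bigr => w wS; rewrite !mxE !enum_rankK /pad uS wS.
rewrite (bigD1 u) //= [X in _ + X]big1 ?addr0 => [|a /andP[aS au]].
  under eq_bigr => w wS do rewrite mulrCA.
  by rewrite -mulr_sumr adjE // eqxx mul1r mulrC.
under eq_bigr => w wS do rewrite mulrCA.
by rewrite -mulr_sumr adjE // eq_sym (negPf au) mul0r mulr0.
Qed.

Lemma fdet_reindex m (h : 'I_m -> V) M : bijective h ->
  \det (\matrix_(i, j) M (h i) (h j)) = fdet M.
Proof.
move=> bh; have em : m = #|V| by rewrite -(bij_eq_card bh) card_ord.
subst m; rewrite /fdet.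
have injs : injective (fun i => enum_rank (h i)).
  by move=> i j /enum_rank_inj /(bij_inj bh).
pose s := perm injs.
have -> : \matrix_(i, j) M (h i) (h j) = row_perm s (col_perm s (fmx M)).
  by apply/matrixP=> i j; rewrite !mxE !permE !enum_rankK.
rewrite row_permE col_permE !det_mulmx !det_perm odd_permV.
by rewrite mulrC -mulrA -expr2 sqrr_sign mulr1.
Qed.

(** The identity block outside [S] contributes a factor [1]; the enumeration [h]
    of [S] allows index types other than subsets of [V]. *)
Lemma minor_sub S M m (h : 'I_m -> V) : injective h ->
    (forall v, (v \in S) = [exists i, h i == v]) ->
  minor S M = \det (\matrix_(i, j) M (h i) (h j)).
Proof.
move=> injh hS.
pose g (i : 'I_(m + #|~: S|)) :=
  match fintype.split i with inl a => h a | inr b => enum_val b end.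
have hmem i : h i \in S by rewrite hS; apply/existsP; exists i.
have nmem (b : 'I_#|~: S|) : enum_val b \notin S by have := enum_valP b; rewrite inE.
have injg : injective g.
  move=> i j gij; rewrite -(splitK i) -(splitK j); move: gij; rewrite /g.
  case: (fintype.split i) => a; case: (fintype.split j) => b /=.
  - by move=> /injh->.
  - by move=> e; have := nmem b; rewrite -e hmem.
  - by move=> e; have := nmem a; rewrite e hmem.
  - by move=> /enum_val_inj->.
have cS : #|S| = m.
  rewrite -[RHS](card_ord m) -(fintype.card_image injh); apply: eq_card => v.
  rewrite hS; apply/existsP/fintype.imageP => [[i /eqP<-]|[i _ ->]]; first by exists i.
  by exists i.
have bg : bijective g.
  by apply: inj_card_bij => //; rewrite card_ord -cS cardsC.
rewrite /minor -(fdet_reindex _ bg).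
have -> : \matrix_(i, j) pad S M (g i) (g j) =
    block_mx (\matrix_(i, j) M (h i) (h j)) 0 0 1%:M.
  apply/matrixP=> i j; rewrite -(splitK i) -(splitK j).
  case: (fintype.split i) => a; case: (fintype.split j) => b;
    rewrite ?block_mxEul ?block_mxEur ?block_mxEdl ?block_mxEdr !mxE;
    rewrite /g ?(unsplitK (inl _)) ?(unsplitK (inr _)) /pad
      ?hmem ?(negPf (nmem _)) ?andbF //=.
  - by case: eqP => // e; have := nmem b; rewrite -e hmem.
  - by case: eqP => // e; have := nmem a; rewrite e hmem.
  - by rewrite (inj_eq enum_val_inj).
by rewrite det_ublock det1 mulr1.
Qed.

Lemma minorT M : minor [set: V] M = fdet M.
Proof. by apply: eq_fdet => a b; rewrite /pad !inE. Qed.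

Lemma minorU S T M : [disjoint S & T] ->
    (forall a b, a \in S -> b \in T -> M a b = 0 /\ M b a = 0) ->
  minor (S :|: T) M = minor S M * minor T M.
Proof.
move=> dST M0; rewrite /minor /fdet -det_mulmx; congr (\det _).
apply/matrixP=> i j; rewrite !mxE; set a := enum_val i; set b := enum_val j.
rewrite (reindex enum_rank) /=; last first.
  by apply: onW_bij; exists enum_val => ?; rewrite ?enum_valK ?enum_rankK.
under eq_bigr do rewrite !mxE !enum_rankK -/a -/b.
have nT v : v \in S -> v \in T = false by apply: disjointFr.
case: (boolP (a \in S)) => aS.
  have [bT|bT] := boolP (b \in T).
    have bS : b \in S = false by apply: contraTF bT => /nT->.
    rewrite {1}/pad !inE aS bT orbT /= (M0 a b aS bT).1 big1 // => w _.
    rewrite /pad aS bT /= andbT; case: ifP => wS.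
      by rewrite nT // (_ : w == b = false) ?mulr0 //; apply: contraTF wS => /eqP->;
        rewrite bS.
    by case: (eqVneq a w) => [e|_]; [rewrite -e aS in wS | rewrite mul0r].
  rewrite (bigD1 b) //= big1 ?addr0 => [|w wb].
    by rewrite /pad !inE aS (negPf bT) !orbF /= eqxx mulr1.
  by rewrite [X in _ * X]/pad (negPf bT) andbF (negPf wb) mulr0.
rewrite (bigD1 a) //= big1 ?addr0 => [|w wa].
  rewrite /pad !inE (negPf aS) /= eqxx mul1r.
  case: (boolP (a \in T)) => //= aT; case: (boolP (b \in T)) => bT /=;
    first by rewrite orbT.
  by case: (boolP (b \in S)) => //= bS;
    rewrite (M0 b a bS aT).2 (_ : a == b = false) //; apply: contraNF bT => /eqP<-.
by rewrite [X in X * _]/pad (negPf aS) /= eq_sym (negPf wa) mul0r.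
Qed.

End FinDet.

Lemma minor_kernel (F : fieldType) (V : finType) (S : {set V}) (M : V -> V -> F) :
  minor S M = 0 -> exists y : V -> F, [/\ exists v, y v != 0,
    forall v, v \notin S -> y v = 0 &
    forall w, w \in S -> \sum_(v in S) y v * M v w = 0].
Proof.
move=> /eqP/det0P[x x0 xM]; pose y v := x 0 (enum_rank v).
have colE w : \sum_v y v * pad S M v w = 0.
  move/rowP/(_ (enum_rank w)): xM; rewrite !mxE => xw; rewrite -[RHS]xw.
  rewrite [RHS](reindex enum_rank) /=; last first.
    by apply: onW_bij; exists enum_val => ?; rewrite ?enum_valK ?enum_rankK.
  by apply: eq_bigr => v _; rewrite mxE !enum_rankK.
have yN w : w \notin S -> y w = 0.
  move=> wS; rewrite -[RHS](colE w) (bigD1 w) //= big1 => [|v vw].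
    by rewrite /pad (negPf wS) eqxx mulr1 addr0.
  by rewrite /pad (negPf wS) andbF (negPf vw) mulr0.
exists y; split=> // [|w wS].
  apply/existsP; apply: contraNT x0; rewrite negb_exists => /forallP y0.
  apply/eqP/rowP=> j; rewrite mxE; apply/eqP; rewrite -[_ == _]negbK.
  by have := y0 (enum_val j); rewrite /y enum_valK.
rewrite -[RHS](colE w) [RHS](bigID (mem S)) /= [X in _ + X]big1 ?addr0.
  by apply: eq_bigr => v vS; rewrite /pad vS wS.
by move=> v vS; rewrite yN // mul0r.
Qed.

Section MinorMorph.
Variables (R R' : comNzRingType) (f : {rmorphism R -> R'}) (V : finType).
Implicit Types (M : V -> V -> R) (S : {set V}).

Lemma fdet_morph M : f (fdet M) = fdet (fun a b => f (M a b)).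
Proof.
by rewrite /fdet -det_map_mx; congr (\det _); apply/matrixP=> i j; rewrite !mxE.
Qed.

Lemma minor_morph S M : f (minor S M) = minor S (fun a b => f (M a b)).
Proof.
rewrite fdet_morph; apply: eq_fdet => a b.
by rewrite /pad; case: ifP => // _; rewrite rmorph_nat.
Qed.
End MinorMorph.

(** * Wronskians and signs of real polynomials *)

Section PolySign.
Variable R : rcfType.
Implicit Types (p q f g : {poly R}) (x y z : R).

Let hE := (hornerD, hornerN, hornerMn, hornerM, horner_exp, hornerX, hornerC).

Definition wronskian p q := p^`() * q - p * q^`().

(** If [p] vanishes at [x] to order [m], then the Wronskian vanishes to order
    [m - 1] with leading coefficient [m] times that of [p] times [q.[x]]; the
    product [(t - x) p W] thus behaves like an even power of [t - x]. *)
Lemma wronskian_near_root p q x : p != 0 -> p.[x] = 0 -> 0 < q.[x] ->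
  exists2 d, 0 < d & forall t, `|t - x| < d -> t != x ->
    0 < (t - x) * p.[t] * (wronskian p q).[t].
Proof.
move=> p0 px qx; have [m [p1 + Ep]] := multiplicity_XsubC p x.
rewrite p0 /= => p1x; case: m => [|k] in Ep *.
  by move: p1x; rewrite /root -(mulr1 p1) -[1](expr0 ('X - x%:P)) -Ep px eqxx.
pose u := p1 * (p1 * q *+ k.+1 + ('X - x%:P) * (p1^`() * q - p1 * q^`())).
have ux : 0 < u.[x].
  have -> : u.[x] = k.+1%:R * (p1.[x] ^+ 2 * q.[x]).
    by rewrite /u !hE -mulr_natl; ring.
  by rewrite mulr_gt0 ?ltr0n // mulr_gt0 // exprn_even_gt0.
have [d d0 ud] := poly_cont x u ux; exists d => // t td tx.
have := ud t td; rewrite ltr_distl subrr => /andP[ut _].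
suff -> : (t - x) * p.[t] * (wronskian p q).[t] = ((t - x) ^+ k.+1) ^+ 2 * u.[t].
  by rewrite mulr_gt0 // exprn_even_gt0 // expf_neq0 // subr_eq0.
rewrite /wronskian /u Ep !derivM deriv_exp derivXsubC /= !hE.
by rewrite -mulr_natl !exprS; ring.
Qed.

Lemma ivt_root_ex p x y : x <= y -> p.[x] * p.[y] <= 0 ->
  exists2 z, x <= z <= y & root p z.
Proof. by move=> xy /(polyrcf.poly_ivt xy)[z zxy pz]; exists z;
  rewrite ?in_itv in zxy *. Qed.

Lemma noroot_gt0 p x y : x <= y -> 0 < p.[x] ->
  (forall z, x < z <= y -> p.[z] != 0) -> 0 < p.[y].
Proof.
move=> xy px nr; rewrite ltNge; apply/negP=> py.
have [z /andP[xz zy]] := @ivt_root_ex p x y xy (mulr_ge0_le0 (ltW px) py).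
rewrite /root => pz; have [xz'|zx] := ltrP x z; last first.
  by rewrite -(eqP pz) (le_anti (introT andP (conj xz zx))) ltxx in px.
by move: (nr z); rewrite xz' zy pz => /(_ isT).
Qed.

Lemma noroot_gt0_left p x y : x <= y -> 0 < p.[y] ->
  (forall z, x <= z < y -> p.[z] != 0) -> 0 < p.[x].
Proof.
move=> xy py nr; rewrite ltNge; apply/negP=> px.
have [z /andP[xz zy]] := @ivt_root_ex p x y xy (mulr_le0_ge0 px (ltW py)).
rewrite /root => pz; have [zy'|yz] := ltrP z y; last first.
  by rewrite -(eqP pz) (le_anti (introT andP (conj zy yz))) ltxx in py.
by move: (nr z); rewrite zy' xz pz => /(_ isT).
Qed.

(** The hypotheses say that [f / g] is nondecreasing above [r].  At the first
    root of [f] after [x] it would have to decrease. *)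
Lemma ratio_gt0_upward f g r x y :
    (forall t, 0 <= (wronskian f g).[t]) ->
    (forall t, r < t -> 0 < g.[t]) ->
  r < x -> x < y -> 0 < f.[x] -> 0 < f.[y].
Proof.
move=> W0 g0 rx xy fx; rewrite ltNge; apply/negP=> fy.
have fn0 : f != 0 by apply: contraTneq fx => ->; rewrite horner0 ltxx.
have y1 : y < y + 1 by rewrite ltrDl.
have x1 : x < y + 1 by apply: lt_trans xy y1.
have [/eqP|z _ fz /itvP zx nz|c _ _ nz] := next_rootP f x (y + 1).
- by rewrite (negPf fn0).
- have rz : r < z by rewrite (lt_trans rx) ?zx.
  have [d d0 H] := wronskian_near_root fn0 fz (g0 z rz).
  have xz : x < z by rewrite zx.
  pose t := Num.max ((x + z) / 2) (z - d / 2).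
  have xt : x < t by rewrite lt_max midf_lt.
  have tz : t < z by rewrite gt_max midf_lt //= ltrBlDr ltrDl divr_gt0.
  have ft : 0 < f.[t].
    apply: (noroot_gt0 (ltW xt) fx) => s /andP[xs st].
    by apply: (nz s); rewrite in_itv /= xs (le_lt_trans st).
  have := H t; rewrite lt_eqF // ltr0_norm ?subr_lt0 // opprB => /(_ _ isT).
  have -> : z - t < d.
    rewrite ltrBlDl -ltrBlDr lt_max; apply/orP; right.
    by rewrite ltrD2l ltrN2 ltr_pdivrMr // mulr_natr mulr2n ltrDl.
  move=> /(_ isT); apply/negP; rewrite -leNgt.
  by rewrite mulr_le0_ge0 // mulr_le0_ge0 // ?ltW // subr_lt0.
- have [z /andP[xz zy] fz] := @ivt_root_ex f x y (ltW xy) (mulr_ge0_le0 (ltW fx) fy).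
  have [xz'|zx] := ltrP x z.
    by move: (nz z); rewrite fz in_itv /= xz' (le_lt_trans zy) // => /(_ isT).
  by move: fz; rewrite /root -(le_anti (introT andP (conj xz zx))) gt_eqF.
Qed.

Lemma wronskianN p q : wronskian q p = - wronskian p q.
Proof. by rewrite /wronskian; ring. Qed.

Lemma lead_coef_noroot_gt0 g r : 0 < lead_coef g ->
  (forall t, r < t -> g.[t] != 0) -> forall t, r < t -> 0 < g.[t].
Proof.
move=> lg nr t rt; have [n gn] := poly_pinfty_gt_lc lg.
pose b := Num.max n t.
have gb : 0 < g.[b] by rewrite (lt_le_trans lg) // gn // le_max lexx.
apply: (@noroot_gt0_left g t b) => //; first by rewrite le_max lexx orbT.
by move=> z /andP[tz _]; rewrite nr // (lt_le_trans rt).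
Qed.

(** If [g] had a root above [r], then to the right of its largest root [f / g]
    would decrease from plus infinity, although it is nondecreasing. *)
Lemma interlaced_gt0 f g r :
    (forall t, 0 <= (wronskian f g).[t]) ->
    (forall t, r < t -> 0 < f.[t]) -> 0 < lead_coef g ->
  forall t, r < t -> 0 < g.[t].
Proof.
move=> W0 f0 lg t rt; rewrite ltNge; apply/negP=> gt.
have gn0 : g != 0 by rewrite -lead_coef_eq0 gt_eqF.
have [n gn] := poly_pinfty_gt_lc lg; pose b := Num.max n t + 1.
have gb : 0 < g.[b] by rewrite (lt_le_trans lg) // gn // ler_wpDr // le_max lexx.
have tb : t < b by rewrite ltr_pwDr // le_max lexx orbT.
have rb := lt_trans rt tb.
have [/eqP|z _ gz /itvP zr nz|c _ _ nz] := prev_rootP g r b.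
- by rewrite (negPf gn0).
- have rz : r < z by rewrite zr.
  have zb : z < b by rewrite zr.
  have [d d0 H] := wronskian_near_root gn0 gz (f0 z rz).
  pose s := Num.min ((z + b) / 2) (z + d / 2).
  have sb : s < b by rewrite gt_min midf_lt.
  have zs : z < s by rewrite lt_min midf_lt //= ltrDl divr_gt0.
  have gs : 0 < g.[s].
    apply: (noroot_gt0_left (ltW sb) gb) => w /andP[sw wb].
    by apply: (nz w); rewrite in_itv /= wb andbT (lt_le_trans zs).
  have := H s; rewrite gt_eqF // gtr0_norm ?subr_gt0 // => /(_ _ isT).
  have -> : s - z < d.
    rewrite ltrBlDl gt_min; apply/orP; right.
    by rewrite ltrD2l ltr_pdivrMr // mulr_natr mulr2n ltrDl.
  move=> /(_ isT); apply/negP; rewrite -leNgt wronskianN hornerN mulrN oppr_le0.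
  by rewrite mulr_ge0 // mulr_ge0 // ltW // subr_gt0.
- have [z /andP[tz zb] gz] := @ivt_root_ex g t b (ltW tb) (mulr_le0_ge0 gt (ltW gb)).
  have [zb'|bz] := ltrP z b.
    by move: (nz z); rewrite gz in_itv /= zb' (lt_le_trans rt) // => /(_ isT).
  by move: gz; rewrite /root (le_anti (introT andP (conj zb bz))) gt_eqF.
Qed.

Local Notation C := R[i].
Local Notation Im := (@complex.Im R).
Local Open Scope complex_scope.

(** Real and imaginary parts along a vertical line, with the factor [e] extracted
    so that [e] may tend to [0]. *)
Lemma horner_complex f x : exists P Q : {poly R},
  [/\ P.[0] = f.[x], Q.[0] = f^`().[x] &
      forall e, (map_poly (real_complex R) f).[x +i* e] = P.[e] +i* (e * Q.[e])].
Proof.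
elim/poly_ind: f => [|f c [P [Q [P0 Q0 PQ]]]].
  by exists 0, 0; split=> *; rewrite ?deriv0 ?rmorph0 ?hornerC ?mulr0.
exists (x%:P * P - 'X * 'X * Q + c%:P), (x%:P * Q + P); split.
- by rewrite !hE P0; ring.
- by rewrite derivD derivM derivX derivC !hE P0 Q0; ring.
- move=> e; rewrite rmorphD rmorphM /= map_polyX map_polyC /= !hE PQ.
  by apply/eqP; rewrite eq_complex /=; apply/andP; split; apply/eqP; ring.
Qed.

(** The hypothesis says that [f / g] has nonnegative imaginary part on the upper
    half-plane; divided by [e], the imaginary part of [f * conj g] tends to the
    Wronskian. *)
Lemma wronskian_ge0 f g :
  (forall x e, 0 < e ->
     0 <= Im ((map_poly (real_complex R) f).[x +i* e] *
              conjc (map_poly (real_complex R) g).[x +i* e])) ->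
  forall t, 0 <= (wronskian f g).[t].
Proof.
move=> H t; have [P [Q [P0 Q0 PQ]]] := horner_complex f t.
have [P' [Q' [P0' Q0' PQ']]] := horner_complex g t.
pose W := Q * P' - P * Q'.
have -> : (wronskian f g).[t] = W.[0] by rewrite !hE P0 Q0 P0' Q0'; ring.
rewrite leNgt; apply/negP=> W0.
have nW0 : 0 < - W.[0] by rewrite oppr_gt0.
have [d d0 Wd] := poly_cont 0 W nW0.
have d2 : 0 < d / 2 by rewrite divr_gt0.
have := Wd (d / 2); rewrite subr0 gtr0_norm // ltr_pdivrMr // mulr_natr mulr2n.
rewrite ltrDl d0 => /(_ isT); rewrite ltr_norml => /andP[_].
rewrite ltrBlDr addNr => Wlt.
have ImE (a b a' b' : R) : Im ((a +i* b) * conjc (a' +i* b')) = b * a' - a * b'.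
  by rewrite /=; ring.
have := H t (d / 2) d2; rewrite PQ PQ' ImE.
have -> : d / 2 * Q.[d / 2] * P'.[d / 2] - P.[d / 2] * (d / 2 * Q'.[d / 2]) =
    d / 2 * W.[d / 2] by rewrite !hE; ring.
by rewrite pmulr_rge0 // leNgt Wlt.
Qed.

End PolySign.

(** * Stability of sums over signings *)

Section Tot.
Variable I : finType.
Local Notation signs := {ffun I -> bool}.

Definition set_sign (i : I) (b : bool) (q : signs) : signs :=
  [ffun k => if k == i then b else q k].

(** The coordinates in [l] range over both signs, the others keep their value in
    [q].  A sum instead of a mean avoids denominators, and the recursion on [l]
    is the tree of conditional expectations. *)
Fixpoint signsum (M : nmodType) (l : seq I) (q : signs) (F : signs -> M) : M :=
  if l is i :: l' then signsum l' (set_sign i true q) F +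
    signsum l' (set_sign i false q) F
  else F q.

Lemma eq_signsum (M : nmodType) l q (F G : signs -> M) : F =1 G ->
  signsum l q F = signsum l q G.
Proof. by move=> FG; elim: l q => [|i l IH] q //=; rewrite !IH. Qed.

Lemma signsumD (M : nmodType) l q (F G : signs -> M) :
  signsum l q (fun q => F q + G q) = signsum l q F + signsum l q G.
Proof. by elim: l q => [|i l IH] q //=; rewrite !IH addrACA. Qed.

Lemma signsum_morph (M N : nmodType) (f : {additive M -> N}) l q (F : signs -> M) :
  f (signsum l q F) = signsum l q (f \o F).
Proof. by elim: l q => [|i l IH] q //=; rewrite raddfD !IH. Qed.

Lemma signsumN (M : zmodType) l q (F : signs -> M) :
  signsum l q (fun q => - F q) = - signsum l q F.
Proof. by elim: l q => [|i l IH] q //=; rewrite !IH opprD. Qed.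

Lemma signsumMl (K : pzRingType) l q (F : signs -> K) (a : K) :
  signsum l q (fun q => a * F q) = a * signsum l q F.
Proof. by elim: l q => [|i l IH] q //=; rewrite !IH mulrDr. Qed.

Lemma signsum_sum (M : nmodType) (T : finType) (P : pred T) l q
    (F : T -> signs -> M) :
  signsum l q (fun q => \sum_(t | P t) F t q) = \sum_(t | P t) signsum l q (F t).
Proof. by elim: l q => [|i l IH] q //=; rewrite !IH big_split. Qed.

Lemma signsum_indep (M : nmodType) i b b' l q (F : signs -> M) :
    (forall q b, F (set_sign i b q) = F q) ->
  signsum l (set_sign i b q) F = signsum l (set_sign i b' q) F.
Proof.
move=> Fi; elim: l q => [|k l IH] q /=; first by rewrite !Fi.
have [->|ki] := eqVneq k i.
  have e c d : set_sign i c (set_sign i d q) = set_sign i c q.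
    by apply/ffunP=> x; rewrite !ffunE; case: eqP.
  by rewrite !e.
have e c d : set_sign k c (set_sign i d q) = set_sign i d (set_sign k c q).
  by apply/ffunP=> x; rewrite !ffunE; case: (x =P k) => // ->; rewrite (negPf ki).
by rewrite !e !(IH (set_sign k _ q)).
Qed.

Definition flip_sign (i : I) (q : signs) : signs := set_sign i (~~ q i) q.

Lemma signsum_flip (M : nmodType) i l q (F : signs -> M) :
  signsum l q (F \o flip_sign i) = signsum l (flip_sign i q) F.
Proof.
elim: l q => [|k l IH] q //=; rewrite !IH.
have [->|ki] := eqVneq k i.
  have e c : flip_sign i (set_sign i c q) = set_sign i (~~ c) q.
    by apply/ffunP=> x; rewrite !ffunE eqxx; case: eqP.
  have e' c : set_sign i c (flip_sign i q) = set_sign i c q.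
    by apply/ffunP=> x; rewrite !ffunE; case: eqP.
  by rewrite !e !e' addrC.
have e c : flip_sign i (set_sign k c q) = set_sign k c (flip_sign i q).
  apply/ffunP=> x; rewrite !ffunE [i == k]eq_sym (negPf ki).
  by case: (x =P i) => [->|//]; rewrite eq_sym (negPf ki).
by rewrite !e.
Qed.

Lemma signsum_flip_mem (M : nmodType) i l q (F : signs -> M) : i \in l ->
  signsum l (flip_sign i q) F = signsum l q F.
Proof.
elim: l q => [|k l IH] q //=; have [->|ki] := eqVneq k i.
  have e' c : set_sign i c (flip_sign i q) = set_sign i c q.
    by apply/ffunP=> x; rewrite !ffunE; case: eqP.
  by rewrite !e'.
rewrite inE eq_sym (negPf ki) /= => il.
have e c : set_sign k c (flip_sign i q) = flip_sign i (set_sign k c q).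
  apply/ffunP=> x; rewrite !ffunE [i == k]eq_sym (negPf ki).
  by case: (x =P i) => [->|//]; rewrite eq_sym (negPf ki).
by rewrite !e !IH.
Qed.

Lemma signsum_odd (K : numDomainType) i l q (F : signs -> K) : i \in l ->
  (forall q, F (flip_sign i q) = - F q) -> signsum l q F = 0.
Proof.
move=> il Fi; have := signsum_flip i l q F; rewrite signsum_flip_mem //.
rewrite (eq_signsum _ _ (Fi : F \o flip_sign i =1 _)) signsumN => /eqP.
by rewrite -subr_eq0 -opprD oppr_eq0 -mulr2n mulrn_eq0 /= => /eqP.
Qed.

End Tot.

Definition sgb {K : pzRingType} (b : bool) : K := (-1) ^+ b.

Lemma sgbN (K : pzRingType) b : sgb (~~ b) = - sgb b :> K.
Proof. by case: b; rewrite /sgb /= ?expr0 ?expr1 ?opprK. Qed.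

Lemma sgb_sqr (K : pzRingType) b : sgb b * sgb b = 1 :> K.
Proof. by rewrite /sgb -signr_addb addbb. Qed.

Section Signed.
Variables (J V : finType) (A : J -> rel V).
Hypotheses (A_sym : forall j, symmetric (A j)) (A_irr : forall j, irreflexive (A j)).
Local Notation signs := {ffun J * V -> bool}.

Definition signed_adj {K : pzRingType} (q : signs) (v w : V) : K :=
  \sum_j (A j v w)%:R * (sgb (q (j, v)) * sgb (q (j, w))).

(** The diagonal carries one variable for each vertex: stability is a property in
    all these variables at once. *)
Definition signed_char {K : pzRingType} (z : V -> K) (q : signs) (v w : V) : K :=
  (v == w)%:R * z v - signed_adj q v w.

Lemma signed_adj_sym (K : comPzRingType) q v w : signed_adj q v w =
  signed_adj q w v :> K.
Proof. by apply: eq_bigr => j _; rewrite A_sym [sgb _ * _]mulrC. Qed.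

Lemma signed_adj_diag (K : pzRingType) q v : signed_adj q v v = 0 :> K.
Proof. by rewrite /signed_adj big1 // => j _; rewrite A_irr mul0r. Qed.

Lemma signed_adj_set (K : pzRingType) j u b q v w : v != u -> w != u ->
  signed_adj (set_sign (j, u) b q) v w = signed_adj q v w :> K.
Proof.
move=> vu wu; apply: eq_bigr => i _; rewrite !ffunE.
by rewrite ![_ == (j, u)]xpair_eqE (negPf vu) (negPf wu) !andbF.
Qed.

Lemma signed_adj_morph (K K' : pzRingType) (f : {rmorphism K -> K'}) q v w :
  f (signed_adj q v w) = signed_adj q v w.
Proof.
rewrite rmorph_sum; apply: eq_bigr => j _.
by rewrite !rmorphM rmorph_nat /= !rmorphXn /= rmorphN rmorph1.
Qed.

Lemma minor_set_sign (K : comNzRingType) (z : V ->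
  K) j u b (S : {set V}) q : u \notin S ->
  minor S (signed_char z (set_sign (j, u) b q)) = minor S (signed_char z q).
Proof.
move=> uS; apply: eq_minor => v w vS wS; rewrite /signed_char signed_adj_set //.
  by apply: contraNneq uS => <-.
by apply: contraNneq uS => <-.
Qed.

Lemma minor_affine (K : comNzRingType) (z z' : V -> K) u (S : {set V}) q : u \in S ->
    (forall v, v != u -> z v = z' v) ->
  minor S (signed_char z q) - minor S (signed_char z' q) =
  (z u - z' u) * minor (S :\ u) (signed_char z q).
Proof.
move=> uS zz'; rewrite !(minor_rec _ uS).
have -> : minor (S :\ u) (signed_char z' q) = minor (S :\ u) (signed_char z q).
  apply: eq_minor => a b; rewrite !inE => /andP[au _] _.
  by rewrite /signed_char zz'.
have -> : \sum_(w in S :\ u) signed_char z' q u w *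
  cramer (S :\ u) (signed_char z' q) ((signed_char z' q)^~ u) w =
  \sum_(w in S :\ u) signed_char z q u w *
    cramer (S :\ u) (signed_char z q) ((signed_char z q)^~ u) w.
  apply: eq_bigr => w; rewrite !inE => /andP[wu _]; congr (_ * _).
    by rewrite /signed_char [u == w]eq_sym (negPf wu) !mul0r.
  apply: eq_cramer => [a b|a]; rewrite !inE => /andP[au _];
    last by rewrite /signed_char zz'.
  by rewrite /signed_char zz'.
by rewrite /signed_char !eqxx !mul1r; ring.
Qed.

End Signed.

Section Stability.
Variables (R : rcfType) (J V : finType) (A : J -> rel V).
Hypotheses (A_sym : forall j, symmetric (A j)) (A_irr : forall j, irreflexive (A j)).
Local Notation signs := {ffun J * V -> bool}.
Local Notation C := R[i].
Local Notation Im := (@complex.Im R).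
Local Notation Re := (@complex.Re R).
Local Open Scope complex_scope.

Let ImD (x y : C) : Im (x + y) = Im x + Im y. Proof. by case: x; case: y. Qed.
Let ImN (x : C) : Im (- x) = - Im x. Proof. by case: x. Qed.
Let Im0 : Im 0 = 0. Proof. by []. Qed.
Let ImZ (a : R) (x : C) : Im (a%:C * x) = a * Im x.
Proof. by case: x => b c /=; rewrite mul0r addr0. Qed.
Let ImMJ (x y : C) : Im (x * conjc y) = Im x * Re y - Re x * Im y.
Proof. by case: x => a b; case: y => c d /=; ring. Qed.
Let Im_sum (I : finType) (P : pred I) (F : I -> C) :
  Im (\sum_(i | P i) F i) = \sum_(i | P i) Im (F i).
Proof. exact: (big_morph Im ImD Im0). Qed.

(** For a kernel vector [y] of [Z - B], the imaginary part of the form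
    [y^* (Z - B) y] is the sum of the [Im z_v |y_v|^2] as [B] is symmetric and
    real, so [y = 0]. *)
Lemma minor_stable (z : V -> C) q (S : {set V}) : (forall v, 0 < Im (z v)) ->
  minor S (signed_char A z q) != 0.
Proof.
move=> z0; apply/negP=> /eqP/minor_kernel[y [[v0 yv0] yN colE]].
pose QS := \sum_(w in S) \sum_(v in S) Im (y v * signed_char A z q v w * conjc (y w)).
have quad : QS = 0.
  apply: big1 => w wS; rewrite -Im_sum -mulr_suml.
  by rewrite colE // mul0r.
pose n2 v := Re (y v) ^+ 2 + Im (y v) ^+ 2.
pose SK : R := \sum_(w in S) \sum_(v in S) signed_adj A q v w * Im (y v * conjc (y w)).
have skew : SK = 0.
  have : SK = - SK.
    rewrite {1}/SK exchange_big /= /SK -sumrN; apply: eq_bigr => v _.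
    rewrite -sumrN; apply: eq_bigr => w _; rewrite (signed_adj_sym A_sym) -mulrN.
    by congr (_ * _); rewrite !ImMJ; ring.
  by move/eqP; rewrite -subr_eq0 opprK -mulr2n mulrn_eq0 /= => /eqP.
have pos : \sum_(w in S) Im (z w) * n2 w = 0.
  transitivity (QS + SK); last by rewrite quad skew addr0.
  rewrite -big_split; apply: eq_bigr => w wS.
  rewrite -big_split (bigD1 w) //= [X in _ + X]big1 ?addr0 => [|v /andP[_ vw]].
    rewrite /signed_char eqxx (signed_adj_diag A_irr) signed_adj_diag // mul1r subr0
      mul0r addr0.
    rewrite /n2; case: (y w) => a b; case: (z w) => c d /=; ring.
  rewrite /signed_char (negPf vw) mul0r sub0r mulrN mulNr ImN.
  rewrite -(signed_adj_morph A (real_complex R)) mulrAC mulrC ImZ; ring.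
have yS w : w \in S -> y w = 0.
  move=> wS; have n2ge v : 0 <= n2 v by rewrite addr_ge0 ?sqr_ge0.
  have /eqP := psumr_eq0P (fun v _ => mulr_ge0 (ltW (z0 v)) (n2ge v)) pos wS.
  rewrite mulf_eq0 gt_eqF //= paddr_eq0 ?sqr_ge0 // !sqrf_eq0 => /andP[/eqP a /eqP b].
  by apply/eqP; rewrite eq_complex a b /= eqxx.
by case/eqP: yv0; case: (boolP (v0 \in S)) => [/yS|/yN].
Qed.

Lemma signsum_affine (K : comNzRingType) (z z' : V ->
  K) u (S : {set V}) l q : u \in S ->
    (forall v, v != u -> z v = z' v) ->
  signsum l q (fun q => minor S (signed_char A z q)) - signsum l q (fun q =>
    minor S (signed_char A z' q)) =
  (z u - z' u) * signsum l q (fun q => minor (S :\ u) (signed_char A z q)).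
Proof.
move=> uS zz'; rewrite -signsumN -signsumD -signsumMl; apply: eq_signsum => q'.
by rewrite (minor_affine A q' uS zz').
Qed.

(** As a function of the variable of [u] the sum is affine, and the point below is
    its root; by stability this root cannot lie in the upper half-plane. *)
Lemma root_Im_le0 (S : {set V}) l q (z : V -> C) u : u \in S ->
    (forall v, 0 < Im (z v)) ->
    (forall z : V -> C, (forall v, 0 < Im (z v)) ->
       signsum l q (fun q => minor S (signed_char A z q)) != 0) ->
    signsum l q (fun q => minor (S :\ u) (signed_char A z q)) != 0 ->
  Im (z u - signsum l q (fun q => minor S (signed_char A z q)) /
            signsum l q (fun q => minor (S :\ u) (signed_char A z q))) <= 0.
Proof.
move=> uS z0 st G0; set F := signsum l q _; set G := signsum l q _ in G0 *.
rewrite leNgt; apply/negP=> w0; set w := z u - F / G in w0.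
pose z' v := if v == u then w else z v.
have z'0 v : 0 < Im (z' v) by rewrite /z'; case: ifP.
have /negP := st z' z'0; apply.
have zz' v : v != u -> z v = z' v by rewrite /z' => /negPf->.
have := signsum_affine l q uS zz'; rewrite -/F -/G {2}/z' eqxx /w subKr.
by rewrite divfK // => /eqP; rewrite -subr_eq0 addrAC subrr add0r oppr_eq0.
Qed.

(** Fixing the sign at [(j, u)] does not change the slope in the variable of [u],
    so a zero of the sum at [z] would make [z u] the mean of two points with
    nonpositive imaginary part. *)
Lemma signsum_stable l q (S : {set V}) (z : V -> C) : (forall v, 0 < Im (z v)) ->
  signsum l q (fun q => minor S (signed_char A z q)) != 0.
Proof.
elim: l q S z => [|[j u] l IH] q S z z0 /=; first exact: minor_stable.
have [uS|uS] := boolP (u \in S); last first.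
  set F := fun q => _; rewrite (@signsum_indep _ _ _ false true) => [|q' b].
    by rewrite -mulr2n mulrn_eq0 /= IH.
  by rewrite /F minor_set_sign.
set F1 := signsum _ _ _; set F0 := signsum _ _ _.
pose G := signsum l (set_sign (j, u) true q) (fun q =>
  minor (S :\ u) (signed_char A z q)).
have GE : signsum l (set_sign (j, u) false q) (fun q =>
  minor (S :\ u) (signed_char A z q)) = G.
  by apply: signsum_indep => q' b; rewrite minor_set_sign // !inE eqxx.
have G0 : G != 0 by apply: IH.
have w1 := root_Im_le0 uS z0 (IH (set_sign (j, u) true q) S) G0.
have := root_Im_le0 uS z0 (IH (set_sign (j, u) false q) S); rewrite GE => /(_ G0) w0.
apply/negP=> /eqP F10.
have := lerD w1 w0; rewrite -/F1 -/F0 -ImD addr0.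
have -> : z u - F1 / G + (z u - F0 / G) = z u + z u.
  by rewrite addrACA -opprD -mulrDl F10 mul0r subr0.
by rewrite ImD leNgt addr_gt0.
Qed.

End Stability.

(** * Interlacing and the choice of a signing *)

Section Expected.
Variables (R : rcfType) (J V : finType) (A : J -> rel V).
Hypotheses (A_sym : forall j, symmetric (A j)) (A_irr : forall j, irreflexive (A j)).
Local Notation signs := {ffun J * V -> bool}.
Implicit Types (S T : {set V}) (l : seq (J * V)) (q : signs).

Definition signsum_minor (K : comNzRingType) l q S (x : K) : K :=
  signsum l q (fun q => minor S (signed_char A (fun=> x) q)).

Lemma signsum_minor_morph (K K' : comNzRingType) (f : {rmorphism K -> K'}) l q S x :
  f (signsum_minor l q S x) = signsum_minor l q S (f x).
Proof.
rewrite signsum_morph; apply: eq_signsum => q' /=; rewrite minor_morph.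
apply: eq_minor => a b _ _.
by rewrite rmorphB rmorphM rmorph_nat signed_adj_morph.
Qed.

Definition signsum_charpoly l q S : {poly R} := signsum_minor l q S 'X.

Lemma horner_signsum_charpoly l q S x :
  (signsum_charpoly l q S).[x] = signsum_minor l q S x.
Proof.
by rewrite -[LHS]/(horner_eval x _) signsum_minor_morph /= /horner_eval hornerX.
Qed.

Lemma minor_charpoly (B : V -> V -> R) S :
  minor S (fun v w => (v == w)%:R * 'X - (B v w)%:P) =
  char_poly (\matrix_(i < #|S|, j < #|S|) B (enum_val i) (enum_val j)).
Proof.
rewrite (@minor_sub _ _ _ _ _ (fun i : 'I_#|S| => enum_val i)); first last.
- move=> v; apply/idP/existsP => [vS|[i /eqP<-]]; last exact: enum_valP.
  by exists (enum_rank_in vS v); rewrite enum_rankK_in.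
- exact: enum_val_inj.
congr (\det _); apply/matrixP=> i j; rewrite !mxE (inj_eq enum_val_inj).
by rewrite mulr_natl.
Qed.

Lemma signsum_charpoly_lead l q S :
  size (signsum_charpoly l q S) = #|S|.+1 /\ 0 < lead_coef (signsum_charpoly l q S).
Proof.
rewrite /signsum_charpoly /signsum_minor; elim: l q => [|i l IH] q /=.
  have -> : minor S (signed_char A (fun=> 'X) q) =
      minor S (fun v w => (v == w)%:R * 'X - (signed_adj A q v w : R)%:P).
    by apply: eq_minor => v w _ _; rewrite /signed_char (signed_adj_morph A (@polyC R)).
  by rewrite minor_charpoly size_char_poly (monicP (char_poly_monic _)) ltr01.
have [s1 l1] := IH (set_sign i true q); have [s2 l2] := IH (set_sign i false q).
set p1 := signsum l _ _ in s1 l1 *; set p2 := signsum l _ _ in s2 l2 *.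
have c : (p1 + p2)`_#|S| = lead_coef p1 + lead_coef p2.
  by rewrite coefD !lead_coefE s1 s2.
have s : size (p1 + p2) = #|S|.+1.
  apply/eqP; rewrite eqn_leq (leq_trans (size_polyD _ _)) ?s1 ?s2 ?maxnn //=.
  by rewrite ltnNge; apply/negP=> /leq_sizeP/(_ _ (leqnn _))/eqP;
    rewrite c gt_eqF ?addr_gt0.
by rewrite s lead_coefE s c addr_gt0.
Qed.

(** By [root_Im_le0] with all variables equal, the ratio of the two polynomials
    has positive imaginary part on the upper half-plane. *)
Lemma signsum_charpoly_interlace l q S u : u \in S ->
  forall t, 0 <= (wronskian (signsum_charpoly l q S)
    (signsum_charpoly l q (S :\ u))).[t].
Proof.
move=> uS; apply: wronskian_ge0 => x e e0.
set z := (x +i* e)%C.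
have ev S' : (map_poly (real_complex R) (signsum_charpoly l q S')).[z] =
  signsum_minor l q S' z.
  rewrite -[LHS]/(horner_eval z _) /signsum_charpoly.
  rewrite (signsum_minor_morph (map_poly (real_complex R))) signsum_minor_morph /=.
  by rewrite map_polyX /horner_eval hornerX.
rewrite !ev; set F := signsum_minor l q S z; set G := signsum_minor _ _ _ _.
have G0 : G != 0 by apply: signsum_stable.
have st (z' : V -> R[i]) : (forall v, 0 < complex.Im (z' v)) ->
    signsum l q (fun q => minor S (signed_char A z' q)) != 0 by apply: signsum_stable.
have := root_Im_le0 uS (fun v => e0 : 0 < complex.Im ((fun _ : V => z) v)) st G0.
rewrite -/(signsum_minor l q S z) -/(signsum_minor l q (S :\ u) z) -/F -/G.
rewrite -{2}[F](divfK G0) -[F / G * G * _]mulrA; case: (F / G) => a b; case: (G) =>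
  c d /=.
rewrite subr_le0 => eb; have b0 : 0 <= b by rewrite (le_trans (ltW e0)).
have := mulr_ge0 b0 (addr_ge0 (sqr_ge0 c) (sqr_ge0 d)); congr (0 <= _); ring.
Qed.

Lemma signsum_charpoly_gt0_sub l q S T r : T \subset S ->
    (forall t, r < t -> 0 < (signsum_charpoly l q S).[t]) ->
  forall t, r < t -> 0 < (signsum_charpoly l q T).[t].
Proof.
have [m] := ubnP #|S :\: T|; elim: m S => // m IH S; rewrite ltnS => cm TS S0.
have [e|[u]] := set_0Vmem (S :\: T).
  suff -> : T = S by [].
  by apply/eqP; rewrite finset.eqEsubset TS -finset.setD_eq0 e eqxx.
rewrite inE => /andP[uT uS]; apply: (IH (S :\ u)).
- have uST : u \in S :\: T by rewrite inE uT.
  have : (#|(S :\: T) :\ u| < #|S :\: T|)%N by rewrite [ltnRHS](cardsD1 u) uST.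
  by rewrite finset.setDDl [T :|: _]finset.setUC -finset.setDDl => /leq_trans; apply.
- by rewrite subsetD1 TS.
- apply: (interlaced_gt0 (signsum_charpoly_interlace l q uS) S0).
  by have [] := signsum_charpoly_lead l q (S :\ u).
Qed.

(** One sign is fixed at a time.  The two polynomials obtained by fixing it have
    the same minor at its vertex, so each of them is positive on an upward closed
    set; these two sets are nested and cover the half-line. *)
Lemma sign_selection l q r :
    (forall t, r < t -> 0 < (signsum_charpoly l q [set: V]).[t]) ->
  exists q', forall t, r < t -> 0 < (signsum_charpoly [::] q' [set: V]).[t].
Proof.
elim: l q => [|[j u] l IH] q; first by exists q.
move=> F0; have uT : u \in [set: V] by rewrite inE.
have G2 := signsum_charpoly_gt0_sub (subsetDl [set: V] [set u]) F0.
pose F b := signsum_charpoly l (set_sign (j, u) b q) [set: V].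
pose G := signsum_charpoly l (set_sign (j, u) true q) ([set: V] :\ u).
have GE : signsum_charpoly l (set_sign (j, u) false q) ([set: V] :\ u) = G.
  by apply: signsum_indep => q' b; rewrite minor_set_sign // !inE eqxx.
have G0 t : r < t -> 0 < G.[t].
  move=> rt; have := G2 t rt; rewrite /signsum_charpoly /signsum_minor /= !hornerD.
  rewrite -[X in _ + X.[_]]/(signsum_charpoly l (set_sign (j, u) false q)
    ([set: V] :\ u)).
  by rewrite GE -/G -mulr2n pmulrn_lgt0.
have up b x y : r < x -> x < y -> 0 < (F b).[x] -> 0 < (F b).[y].
  apply: (ratio_gt0_upward (g := G)) => //.
  by case: b; [|rewrite -GE]; apply: signsum_charpoly_interlace.
have win b : (forall x, r < x -> 0 < (F b).[x]) ->
    exists q', forall t, r < t -> 0 < (signsum_charpoly [::] q' [set: V]).[t].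
  exact: IH.
case: (pselect (forall x, r < x -> 0 < (F true).[x])) => [|/existsNP[x]].
  exact: win.
move=> /not_implyP[rx /negP F1x];
  case: (pselect (forall x, r < x -> 0 < (F false).[x])).
  exact: win.
move=> /existsNP[y /not_implyP[ry /negP F0y]].
(* both polynomials are nonpositive at the smaller of the two bad points *)
pose m := Num.min x y; have rm : r < m by rewrite lt_min rx.
have Fm b z : m <= z -> ~~ (0 < (F b).[z]) -> (F b).[m] <= 0.
  move=> mz; rewrite leNgt; apply: contra => Fbm.
  by move: mz; rewrite le_eqVlt => /predU1P[<- //|mz]; apply: (up b m).
have := F0 m rm; rewrite /signsum_charpoly /signsum_minor /= hornerD ltNge.
move=> /negP[]; rewrite -[0]addr0 lerD //.
  by apply: (Fm true x) => //; rewrite /m ge_min lexx.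
by apply: (Fm false y) => //; rewrite /m ge_min lexx orbT.
Qed.
End Expected.

(** * Signed sums against finite subgraphs of a cover *)

(** Used to compare sums over neighbors: [f] lifts neighbors injectively. *)
Lemma ler_sum_inj (K : numDomainType) (I I' : finType) (P : pred I) (Q : pred I')
    (f : I -> I') (F : I -> K) (G : I' -> K) :
    (forall i, P i -> Q (f i)) -> {in P &, injective f} ->
    (forall i, P i -> F i <= G (f i)) -> (forall i, Q i -> 0 <= G i) ->
  \sum_(i | P i) F i <= \sum_(i | Q i) G i.
Proof.
move=> PQ injf FG G0; apply: le_trans (ler_sum _ FG) _.
rewrite -(big_imset (fun i => G i) injf) /=.
rewrite [leRHS](bigID (mem [set f i | i in P])) /= [X in _ <= X + _](_ : _ =
  \sum_(i in [set f i | i in P]) G i).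
  by rewrite lerDl sumr_ge0 // => i /andP[/G0].
apply: eq_bigl => i; apply: andb_idl => /imsetP[k Pk ->]; exact: PQ.
Qed.

Section SignedRec.
Variables (K : realDomainType) (J V : finType) (A : J -> rel V).
Hypotheses (A_irr : forall j, irreflexive (A j)).
Local Notation signs := {ffun J * V -> bool}.
Variables (l : seq (J * V)) (q0 : signs) (x : K).
Hypothesis l_full : forall i, i \in l.
Implicit Types (S : {set V}).

Let M (q : signs) := signed_char A (fun=> x) q.
Let a S := signsum_minor A l q0 S x.

(** Up to normalization, the averaged weight of the simple paths in [S] that go
    from [v] back to [u] inside the atom [j]. *)
Definition signsum_path j S v u : K :=
  signsum l q0 (fun q => sgb (q (j, v)) *
    sgb (q (j, u)) * - cramer S (M q) ((M q)^~ u) v).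

Lemma signsum_minor_rec S u : u \notin S ->
  a (u |: S) = x * a S - \sum_(p : J * V | p.2 \in S) (A p.1 u p.2)%:R *
    signsum_path p.1 S p.2 u.
Proof.
move=> uS; rewrite /a /signsum_minor -signsumMl.
transitivity (signsum l q0 (fun q => x * minor S (M q) -
    \sum_(p : J * V | p.2 \in S) (A p.1 u p.2)%:R *
       (sgb (q (p.1, p.2)) * sgb (q (p.1, u)) * - cramer S (M q) ((M q)^~ u) p.2))).
  apply: eq_signsum => q; rewrite (minor_rec _ (setU11 u S)) setU1K //.
  rewrite {1}/signed_char eqxx mul1r signed_adj_diag // subr0; congr (_ - _).
  rewrite -[RHS](pair_big_dep predT (fun _ v => v \in S) (fun j v =>
    (A j u v)%:R * (sgb (q (j, v)) *
      sgb (q (j, u)) * - cramer S (M q) ((M q)^~ u) v))) /=.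
  rewrite exchange_big /=; apply: eq_bigr => w wS.
  have uw : u == w = false by apply: contraNF uS => /eqP->.
  rewrite {1}/signed_char uw mul0r sub0r /signed_adj mulNr -mulrN mulr_suml.
  by apply: eq_bigr => j _; rewrite -mulrA [sgb (q (j, u)) * _]mulrC.
rewrite signsumD; congr (_ + _); rewrite signsumN signsum_sum; congr (- _).
by apply: eq_bigr => p _; rewrite signsumMl.
Qed.

(** The sign at [(i, v)] occurs only once when [i != j], hence the two values
    cancel. *)
Lemma signsum_orth i j v (H : signs -> K) : (forall q, H (flip_sign (i, v) q) = H q) ->
  signsum l q0 (fun q => sgb (q (j, v)) * sgb (q (i, v)) * H q) =
  (i == j)%:R * signsum l q0 H.
Proof.
move=> Hf; have [->|ij] := eqVneq i j.
  by rewrite mul1r; apply: eq_signsum => q; rewrite sgb_sqr mul1r.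
rewrite mul0r; apply: (@signsum_odd _ K (i,v)) => // q; rewrite Hf !ffunE eqxx.
by rewrite xpair_eqE eq_sym (negPf ij) /= sgbN mulrN mulNr.
Qed.

(** In the row expansion at [v] the signs at [v] occur only in the step that
    enters [v], made in the atom [j], and in the step that leaves it; by
    orthogonality only the paths that stay in the atom [j] survive. *)
Lemma signsum_path_rec j S v u : v \in S -> u \notin S ->
  signsum_path j S v u = (A j v u)%:R * a (S :\ v)
    + \sum_(w in S :\ v) (A j v w)%:R * signsum_path j (S :\ v) w u.
Proof.
move=> vS uS; have uv : u != v by apply: contraNneq uS => ->.
have Mflip i q b c : b != v -> c != v -> M (flip_sign (i, v) q) b c = M q b c.
  by move=> bv cv; rewrite /M /signed_char signed_adj_set.
have qflip (i k : J) (q : signs) w : w != v -> (flip_sign (i, v) q) (k, w) = q (k, w).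
  by move=> wv; rewrite ffunE xpair_eqE (negPf wv) andbF.
have cflip i q w : w != v ->
  cramer (S :\ v) (M (flip_sign (i, v) q)) ((M (flip_sign (i, v) q))^~ u) w =
    cramer (S :\ v) (M q) ((M q)^~ u) w.
  move=> wv; apply: eq_cramer => [b c|b]; rewrite !inE => /andP[bv _].
    by move=> /andP[cv _]; apply: Mflip.
  exact: Mflip.
have mflip i q : minor (S :\ v) (M (flip_sign (i, v) q)) = minor (S :\ v) (M q).
  by apply: eq_minor => b c; rewrite !inE => /andP[bv _] /andP[cv _]; apply: Mflip.
transitivity (signsum l q0 (fun q =>
  \sum_i (A i v u)%:R * (sgb (q (j, v)) * sgb (q (i, v)) *
    (sgb (q (j, u)) * sgb (q (i, u)) * minor (S :\ v) (M q)))
  + \sum_(w in S :\ v) \sum_i (A i v w)%:R *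
     (sgb (q (j, v)) * sgb (q (i, v)) *
       (sgb (q (j, u)) * sgb (q (i, w)) * - cramer (S :\ v) (M q) ((M q)^~ u) w)))).
  apply: eq_signsum => q; rewrite (cramer_rec _ _ vS) opprB addrC mulrDr; congr (_ + _).
    rewrite {1}/M /signed_char eq_sym (negPf uv) mul0r sub0r mulNr opprK /signed_adj
      mulr_suml mulr_sumr.
    by apply: eq_bigr => i _; ring.
  rewrite mulr_sumr; apply: eq_bigr => w; rewrite !inE => /andP[wv _].
  rewrite {1}/M /signed_char eq_sym (negPf wv) mul0r sub0r mulNr -[- (_ * _)]mulrN.
  rewrite /signed_adj mulr_suml mulr_sumr.
  by apply: eq_bigr => i _; ring.
rewrite signsumD; congr (_ + _).
  rewrite signsum_sum (bigD1 j) //= signsumMl signsum_orth => [|q];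
    last by rewrite !qflip // mflip.
  rewrite eqxx mul1r [X in _ + X]big1 ?addr0 => [|i ij].
    by congr (_ * _); apply: eq_signsum => q; rewrite sgb_sqr mul1r.
  rewrite signsumMl signsum_orth => [|q]; last by rewrite !qflip // mflip.
  by rewrite (negPf ij) mul0r mulr0.
rewrite signsum_sum; apply: eq_bigr => w; rewrite !inE => /andP[wv _].
rewrite signsum_sum (bigD1 j) //= signsumMl signsum_orth => [|q];
  last by rewrite !qflip // cflip.
rewrite eqxx mul1r [X in _ + X]big1 ?addr0 => [|i ij].
  by congr (_ * _); apply: eq_signsum => q; rewrite [sgb (q (j, u)) * _]mulrC.
rewrite signsumMl signsum_orth => [|q]; last by rewrite !qflip // cflip.
by rewrite (negPf ij) mul0r mulr0.
Qed.

End SignedRec.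

Section GraphRec.
Variables (K : realDomainType) (W : finType) (e : rel W) (x : K).
Hypothesis e_irr : irreflexive e.
Implicit Types T : {set W}.

Definition adj_char (v w : W) : K := (v == w)%:R * x - (e v w)%:R.
Definition adj_minor T : K := minor T adj_char.

(** The counterpart of [signsum_path] without signs, where the paths may use all
    edges. *)
Definition adj_path T v u : K := - cramer T adj_char (adj_char^~ u) v.

Lemma adj_minor_rec T u : u \notin T ->
  adj_minor (u |: T) = x * adj_minor T - \sum_(v in T) (e u v)%:R * adj_path T v u.
Proof.
move=> uT; rewrite /adj_minor (minor_rec _ (setU11 u T)) setU1K //.
rewrite {1}/adj_char eqxx mul1r e_irr subr0; congr (_ - _).
apply: eq_bigr => w wS; have uw : u == w = false by apply: contraNF uT => /eqP->.
by rewrite {1}/adj_char uw mul0r sub0r mulNr -mulrN.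
Qed.

Lemma adj_path_rec T v u : v \in T -> u \notin T ->
  adj_path T v u = (e v u)%:R * adj_minor (T :\ v)
    + \sum_(w in T :\ v) (e v w)%:R * adj_path (T :\ v) w u.
Proof.
move=> vT uT; have uv : u != v by apply: contraNneq uT => ->.
rewrite /adj_path (cramer_rec _ _ vT) opprB addrC; congr (_ + _).
  by rewrite {1}/adj_char eq_sym (negPf uv) mul0r sub0r mulNr opprK.
apply: eq_bigr => w; rewrite !inE => /andP[wv _].
by rewrite {1}/adj_char eq_sym (negPf wv) mul0r sub0r mulNr -mulrN.
Qed.

Hypothesis adj_minor_gt0 : forall T, 0 < adj_minor T.

Lemma adj_path_ge0 T v u : v \in T -> u \notin T -> 0 <= adj_path T v u.
Proof.
have [m] := ubnP #|T|; elim: m T v => // m IH T v; rewrite ltnS => cT vT uT.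
rewrite adj_path_rec //; apply: addr_ge0; first by rewrite mulr_ge0 ?ler0n ?ltW.
apply: sumr_ge0 => w wT; rewrite mulr_ge0 ?ler0n // IH //.
  by move: cT; rewrite (cardsD1 v T) vT.
by rewrite !inE negb_and uT orbT.
Qed.
End GraphRec.

Section Compare.
Variables (K : realDomainType) (J V : finType) (A : J -> rel V).
Hypotheses (A_irr : forall j, irreflexive (A j)).
Variables (l : seq (J * V)) (q0 : {ffun J * V -> bool}) (x : K).
Hypothesis l_full : forall i, i \in l.
Local Notation a S := (signsum_minor A l q0 S x).

Variables (Y : eqType) (eY : rel Y) (proj : Y -> V).
Variables (lift : J -> Y -> V -> Y) (copy : J -> Y -> Y -> Prop).
Hypothesis lift_pi : forall j y v, A j (proj y) v -> proj (lift j y v) = v.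
Hypothesis lift_inj : forall j j' y v v', A j (proj y) v -> A j' (proj y) v' ->
  lift j y v = lift j' y v' -> j = j'.
Hypothesis lift_copy : forall j y v, A j (proj y) v -> copy j y (lift j y v).
Hypothesis copy_sym : forall j y z, copy j y z -> copy j z y.
Hypothesis copy_trans : forall j y z t, copy j y z -> copy j z t -> copy j y t.
Hypothesis copy_edge : forall j y z, copy j y z -> A j (proj y) (proj z) -> eY y z.

Variables (W : finType) (iota : W -> Y).
Implicit Types (S : {set V}) (T : {set W}).
Hypothesis iota_inj : injective iota.
Let e : rel W := relpre iota eY.
Hypothesis e_irr : irreflexive e.
Local Notation phi := (adj_minor e x).
Hypothesis phi_gt0 : forall T, 0 < phi T.

Definition inimg (T : {set W}) (z : Y) := [exists w in T, iota w == z].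

(** [T] contains all that the recursion on [S] can reach.  As that recursion
    removes from [S] the projection of the path already taken, only paths with
    injective projection matter, so that finite sets [T] suffice. *)
Definition covered (S : {set V}) (T : {set W}) (y : Y) :=
  forall p, path eY y p -> uniq (map proj p) ->
    all (fun z => (proj z \in S) && (proj z != proj y)) p -> all (inimg T) p.

Lemma covered_step S T y z : eY y z -> proj z \in S -> proj z != proj y ->
  covered S T y -> covered (S :\ proj y) T z /\ inimg T z.
Proof.
move=> yz zS zy cov; split.
  move=> p zp up Sp.
  have := cov (z :: p); rewrite /= yz zp up zS zy /= !andbT => /(_ isT).
  have -> : proj z \notin [seq proj i | i <- p].
    apply/mapP=> -[t tp ezt]; have := allP Sp t tp.
    by rewrite ezt eqxx andbF.
  move=> /(_ isT); case/(_ _)/andP => //.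
  apply: sub_all Sp => t; rewrite !inE => /andP[/andP[last_type ->] _].
  by rewrite last_type.
by have := cov [:: z]; rewrite /= yz zS zy /= andbT; apply.
Qed.

Lemma coveredW S S' T T' y : S' \subset S ->
    (forall z, proj z \in S' -> inimg T z -> inimg T' z) ->
  covered S T y -> covered S' T' y.
Proof.
move=> SS TT cov p yp up Sp; have Tp := cov p yp up.
have {}Tp : all (inimg T) p.
  by apply: Tp; apply: sub_all Sp => z /andP[/(fintype.subsetP SS)-> ->].
apply/allP=> z zp; apply: TT; last by apply: (allP Tp).
by have /andP[] := allP Sp z zp.
Qed.

Lemma inimgD1 (S : {set V}) T w z : proj z \in S :\ proj (iota w) -> inimg T z ->
  inimg (T :\ w) z.
Proof.
rewrite !inE => /andP[ne _] /exists_inP[t tT /eqP tz]; apply/exists_inP; exists t;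
  last exact/eqP.
by rewrite !inE tT andbT; apply: contraNneq ne => <-; rewrite tz.
Qed.

Variable k : nat.
Hypothesis a_gt0 : forall S, (#|S| <= k)%N -> 0 < a S.

(** Both sides obey recursions of the same shape.  Path weights for [S] are
    compared by means of both parts for [S :\ v], and ratios of minors for [S] by
    means of path weights for [S]; neighbors inside atoms lift injectively, and
    the remaining terms in the cover are nonnegative. *)
Lemma compare_ind S : (#|S| <= k)%N ->
  (forall T u, proj (iota u) \notin S -> u \notin T -> covered S T (iota u) ->
     phi (u |: T) * a S <= a (proj (iota u) |: S) * phi T) /\
  (forall T v u j, proj (iota v) \in S -> proj (iota u) \notin S -> v \in T ->
     u \notin T -> copy j (iota v) (iota u) -> covered S T (iota v) ->
     0 <= signsum_path A l q0 x j S (proj (iota v)) (proj (iota u)) /\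
     signsum_path A l q0 x j S (proj (iota v)) (proj (iota u)) * phi T <=
       adj_path e x T v u * a S).
Proof.
have [m] := ubnP #|S|; elim: m S => // m IH S; rewrite ltnS => cS Sk.
have I2 T v u j : proj (iota v) \in S -> proj (iota u) \notin S -> v \in T ->
     u \notin T -> copy j (iota v) (iota u) -> covered S T (iota v) ->
     0 <= signsum_path A l q0 x j S (proj (iota v)) (proj (iota u)) /\
     signsum_path A l q0 x j S (proj (iota v)) (proj (iota u)) * phi T <=
       adj_path e x T v u * a S.
  move=> vS uS vT uT cvu cov; set v' := proj _ in vS *; set u' := proj _ in uS *.
  have cSv : (#|S :\ v'| < m)%N by move: cS; rewrite (cardsD1 v' S) vS.
  have kSv : (#|S :\ v'| <= k)%N.
    by apply: leq_trans Sk; rewrite [leqRHS](cardsD1 v') leq_addl.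
  have [IH1 IH2] := IH _ cSv kSv.
  have a0 := a_gt0 kSv.
  have uSv : u' \notin S :\ v' by rewrite !inE negb_and uS orbT.
  have uTv : u \notin T :\ v by rewrite !inE negb_and uT orbT.
  have ratio : phi T * a (S :\ v') <= a S * phi (T :\ v).
    have := IH1 (T :\ v) v; rewrite -/v' !finset.setD1K //; apply.
    - by rewrite !inE eqxx.
    - by rewrite !inE eqxx.
    - apply: coveredW cov; first exact: subD1set.
      by move=> z zS Tz; apply: (@inimgD1 S).
  have next w : w \in S :\ v' -> A j v' w -> exists2 w1, w1 \in T :\ v &
      [/\ iota w1 = lift j (iota v) w, proj (iota w1) = w, e v w1,
          copy j (iota w1) (iota u) & covered (S :\ v') (T :\ v) (iota w1)].
    rewrite inE => /andP[]; rewrite inE => wv wS Aw.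
    have piw := lift_pi Aw; have cw := lift_copy Aw.
    have ew : eY (iota v) (lift j (iota v) w) by apply: (copy_edge cw); rewrite piw.
    have [] := covered_step ew _ _ cov; rewrite ?piw //.
    rewrite -/v' => cov' /[dup] Tw.
    have : inimg (T :\ v) (lift j (iota v) w).
      by apply: (@inimgD1 S) => //; rewrite piw !inE wv.
    move=> /exists_inP[w1 w1T /eqP w1E] _; exists w1 => //; split => //.
    - by rewrite w1E.
    - by rewrite /e /= w1E.
    - by rewrite w1E; apply: copy_trans (copy_sym cw) cvu.
    - rewrite w1E; apply: coveredW cov' => // z zS Tz.
      exact: (@inimgD1 S).
  have AE : (A j v' u')%:R <= (e v u)%:R :> K.
    by case: (boolP (A j v' u')) => [/(copy_edge cvu) evu|_];
      rewrite ?ler0n // /e /= evu.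
  have Tge w : w \in S :\ v' ->
    0 <= (A j v' w)%:R * signsum_path A l q0 x j (S :\ v') w u'.
    move=> wS; case: (boolP (A j v' w)) => [Aw|_]; last by rewrite mul0r.
    have [w1 w1T [_ piw _ cw1 cov1]] := next w wS Aw.
    rewrite mul1r -piw; case: (IH2 (T :\ v) w1 u j) => //.
    by rewrite piw.
  have kge w : w \in T :\ v -> 0 <= (e v w)%:R * adj_path e x (T :\ v) w u.
    by move=> wT; rewrite mulr_ge0 ?ler0n // adj_path_ge0.
  set Q := signsum_path A l q0 x j S v' u'.
  have QE : Q = (A j v' u')%:R * a (S :\ v')
     + \sum_(w in S :\ v') (A j v' w)%:R * signsum_path A l q0 x j (S :\ v') w u'.
    exact: signsum_path_rec.
  have Q0 : 0 <= Q.
    by rewrite QE addr_ge0 ?sumr_ge0 // mulr_ge0 ?ler0n // ltW.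
  have QP : Q * phi (T :\ v) <= adj_path e x T v u * a (S :\ v').
    rewrite QE adj_path_rec // !mulrDl lerD //.
      rewrite -!mulrA [phi _ * _]mulrC ler_wpM2r // mulr_ge0 // ltW //.
    rewrite !mulr_suml (bigID (A j v')) /= [X in _ + X]big1 ?addr0 =>
      [|w /andP[_ /negPf->]]; last first.
      by rewrite !mul0r.
    pose f w := odflt v [pick w1 in T :\ v | iota w1 == lift j (iota v) w].
    have fE w : w \in S :\ v' -> A j v' w ->
      f w \in T :\ v /\ iota (f w) = lift j (iota v) w.
      move=> wS Aw; rewrite /f; case: pickP => [w1 /andP[? /eqP ?] //|/= no].
      by have [w1 w1T [w1E _ _ _ _]] := next w wS Aw; move: (no w1);
        rewrite w1T w1E eqxx.
    apply: (@ler_sum_inj _ _ _ _ _ f) =>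
      [w /andP[wS Aw]|w w2 /andP[wS Aw] /andP[w2S Aw2] eqf|w /andP[wS Aw]|w wT].
    - by have [] := fE w wS Aw.
    - have [_ f1] := fE w wS Aw; have [_ f2] := fE w2 w2S Aw2.
      by rewrite -(lift_pi Aw) -f1 eqf f2 (lift_pi Aw2).
    - have [fT fw] := fE w wS Aw; have [w1 w1T [w1E piw ew cw1 cov1]] := next w wS Aw.
      have ef : f w = w1 by apply: iota_inj; rewrite fw w1E.
      rewrite ef Aw ew !mul1r -{1}piw.
      by case: (IH2 (T :\ v) w1 u j) => //; rewrite piw.
    - by rewrite mulr_ge0 ?kge // ltW.
  split=> //; rewrite -(ler_pM2r a0) -mulrA.
  apply: le_trans (_ : Q * (a S * phi (T :\ v)) <= _); first by rewrite ler_wpM2l.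
  by rewrite mulrCA [leRHS]mulrAC [leRHS]mulrC ler_wpM2l // ltW // a_gt0.
split=> // T u uS uT cov; set u' := proj _ in uS *.
rewrite (signsum_minor_rec A_irr) // adj_minor_rec // !mulrBl.
rewrite -mulrA [phi T * _]mulrC mulrA lerD2l lerN2 !mulr_suml.
rewrite (bigID (fun p : J * V => A p.1 u' p.2)) /= [X in _ + X]big1 ?addr0 =>
  [|p /andP[_ /negPf->]]; last first.
  by rewrite !mul0r.
have next (p : J * V) : p.2 \in S -> A p.1 u' p.2 -> exists2 w1, w1 \in T &
    [/\ iota w1 = lift p.1 (iota u) p.2, proj (iota w1) = p.2, e u w1,
        copy p.1 (iota w1) (iota u) & covered S T (iota w1)].
  case: p => j w /= wS Aw.
  have piw := lift_pi Aw; have cw := lift_copy Aw.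
  have ew : eY (iota u) (lift j (iota u) w) by apply: (copy_edge cw); rewrite piw.
  have wu : w != u' by apply: contraNneq uS => <-.
  have [] := covered_step ew _ _ cov; rewrite ?piw //.
  move=> cov' /exists_inP[w1 w1T /eqP w1E]; exists w1 => //; split => //.
  - by rewrite w1E.
  - by rewrite /e /= w1E.
  - by rewrite w1E; apply: copy_sym.
  - rewrite w1E; suff <- : S :\ u' = S by [].
    by apply/setP=> z; rewrite !inE; case: eqP => // ->; rewrite (negPf uS).
pose f p := odflt u [pick w1 in T | iota w1 == lift p.1 (iota u) p.2].
have fE p : p.2 \in S -> A p.1 u' p.2 ->
  f p \in T /\ iota (f p) = lift p.1 (iota u) p.2.
  move=> pS Ap; rewrite /f; case: pickP => [w1 /andP[? /eqP ?] //|/= no].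
  by have [w1 w1T [w1E _ _ _ _]] := next p pS Ap; move: (no w1); rewrite w1T w1E eqxx.
apply: (@ler_sum_inj _ _ _ _ _ f) =>
  [p /andP[pS Ap]|p p2 /andP[pS Ap] /andP[p2S Ap2] eqf|p /andP[pS Ap]|w wT].
- by have [] := fE p pS Ap.
- have [_ f1] := fE p pS Ap; have [_ f2] := fE p2 p2S Ap2.
  move: f1; rewrite eqf f2 => el; have e1 := lift_inj Ap2 Ap el.
  have e2 : p.2 = p2.2 by rewrite -(lift_pi Ap) -el (lift_pi Ap2).
  by case: (p) (p2) e1 e2 => [? ?] [? ?] /= -> ->.
- have [fT fp] := fE p pS Ap; have [w1 w1T [w1E pip ew cw1 cov1]] := next p pS Ap.
  have ef : f p = w1 by apply: iota_inj; rewrite fp w1E.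
  rewrite ef Ap ew !mul1r -{1}pip.
  by case: (I2 T w1 u p.1) => //; rewrite pip.
- by rewrite mulr_ge0 ?mulr_ge0 ?ler0n ?adj_path_ge0 // ltW // a_gt0.
Qed.

End Compare.

(** * Strings and the additive product *)

Section Strings.
Variables (n c : nat) (A : 'I_c -> rel 'I_n) (v1 : 'I_n).
Hypotheses (A_sym : forall j, symmetric (A j)) (A_irr : forall j, irreflexive (A j)).
Local Notation letter := ('I_c * 'I_n)%type.
Implicit Types (s t : seq letter) (C D : 'I_c) (u v w : 'I_n).

Definition last_type s : 'I_n := last v1 (map snd s).
Definition last_color (p : option 'I_c) s : option 'I_c :=
  last p (map (fun x => Some x.1) s).

Lemma last_type_rcons s C u : last_type (rcons s (C, u)) = u.
Proof. by rewrite /last_type map_rcons last_rcons. Qed.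

Lemma valid_rcons p a s C u : valid A p a (rcons s (C, u)) =
  valid A p a s && [&& last_color p s != Some C, last a (map snd s) != u,
                       nonisolated A C (last a (map snd s)) & nonisolated A C u].
Proof.
elim: s p a => [|[D w] s IH] p a /=; first by rewrite andbT.
by rewrite IH /last_color /= -!andbA.
Qed.

(** The vertex of type [u] in the copy of the atom [C] through the string.  If the
    last letter has color [C], this copy contains the parent string and the letter
    is replaced or dropped; otherwise the copy hangs below the string. *)
Definition str_move C s u : seq letter :=
  if rev s is (D, w) :: r then
    if D == C then
      if u == last_type (rev r) then rev r else rcons (rev r) (C, u)
    else if u == w then s else rcons s (C, u)
  else if u == v1 then s else rcons s (C, u).

Lemma str_move_nil C u : str_move C [::] u = if u == v1 then [::] else [:: (C, u)].
Proof. by []. Qed.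

Lemma str_move_rcons C s D w u : str_move C (rcons s (D, w)) u =
  if D == C then if u == last_type s then s else rcons s (C, u)
  else if u == w then rcons s (D, w) else rcons (rcons s (D, w)) (C, u).
Proof. by rewrite /str_move rev_rcons revK. Qed.

Lemma str_move_ext C s u : last_color None s != Some C ->
  str_move C s u = if u == last_type s then s else rcons s (C, u).
Proof.
case/lastP: s => [|s [D w]]; first by rewrite str_move_nil.
rewrite /last_color map_rcons last_rcons str_move_rcons last_type_rcons => DC.
by have /negPf-> : D != C := DC.
Qed.

Lemma last_type_move C s u : last_type (str_move C s u) = u.
Proof.
case/lastP: s => [|s [D w]]; first by rewrite str_move_nil; case: eqP => [->|].
rewrite str_move_rcons; case: eqP => _.
  by case: eqP => [->|]; rewrite ?last_type_rcons.
by case: eqP => [->|]; rewrite ?last_type_rcons.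
Qed.

(** Each copy of an atom has a vertex closest to the root, the base [b]: the
    other vertices of the copy extend [b] by one letter. *)
Lemma str_base C s : valid A None v1 s -> exists2 b, valid A None v1 b &
  last_color None b != Some C /\ (s = b \/ exists w,
    [/\ s = rcons b (C, w), last_type b != w,
      nonisolated A C (last_type b) & nonisolated A C w]).
Proof.
case/lastP: s => [|s [D w]]; first by exists [::] => //; split => //; left.
move=> vs; have [eDC|DC] := eqVneq D C.
  move: vs; rewrite eDC valid_rcons => /andP[vs /and4P[? ? ? ?]].
  by exists s => //; split => //; right; exists w.
exists (rcons s (D, w)) => //; split; last by left.
by rewrite /last_color map_rcons last_rcons /=; apply: contraNneq DC => -[->].
Qed.

Lemma str_move_base C b w u : str_move C (rcons b (C, w)) u =
  if u == last_type b then b else rcons b (C, u).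
Proof. by rewrite str_move_rcons eqxx. Qed.

Lemma str_move_id C s : valid A None v1 s -> str_move C s (last_type s) = s.
Proof.
move=> /(str_base C)[b vb [bC [->|[w [-> bw _ _]]]]];
  first by rewrite str_move_ext // eqxx.
by rewrite str_move_base last_type_rcons eq_sym (negPf bw).
Qed.

Lemma str_move_move C s u w : valid A None v1 s ->
  str_move C (str_move C s u) w = str_move C s w.
Proof.
move=> /(str_base C)[b vb [bC [->|[z [-> bz _ _]]]]].
  rewrite [X in str_move C X w]str_move_ext // [RHS]str_move_ext //.
  by case: (u =P last_type b) => [_|_]; rewrite ?str_move_base // str_move_ext.
rewrite !str_move_base.
by case: (u =P last_type b) => [_|_]; rewrite ?str_move_base // str_move_ext.
Qed.

Lemma valid_move C s u : valid A None v1 s -> nonisolated A C (last_type s) ->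
  nonisolated A C u -> valid A None v1 (str_move C s u).
Proof.
move=> /(str_base C)[b vb [bC [->|[z [-> bz nb nz]]]]].
  move=> ns nu; rewrite str_move_ext //; case: eqP => // /eqP ub.
  by rewrite valid_rcons vb bC eq_sym ub ns nu.
move=> _ nu; rewrite str_move_base; case: eqP => // /eqP ub.
by rewrite valid_rcons vb bC eq_sym ub nb nu.
Qed.

Lemma str_move_inj C C' s u u' : valid A None v1 s -> u != last_type s ->
  str_move C s u = str_move C' s u' -> C = C'.
Proof.
move=> vs us e; have euu : u = u' by rewrite -(last_type_move C s u) e last_type_move.
subst u'; move: vs us e.
case/lastP: s => [|s [D w]] vs us.
  by rewrite !str_move_nil (negPf us) => -[].
move: us; rewrite last_type_rcons => us; rewrite !str_move_rcons (negPf us).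
have [eD|DC] := eqVneq D C; have [eD'|DC'] := eqVneq D C'.
- by rewrite -eD eD'.
- case: ifP => _ /(congr1 size); rewrite !size_rcons => /eqP.
    by rewrite -[X in X == _]addn0 -addn2 eqn_add2l.
  by rewrite -[X in X == _]addn1 -[X in _ == X]addn2 eqn_add2l.
- case: ifP => _ /(congr1 size); rewrite !size_rcons => /eqP.
    by rewrite eq_sym -[X in X == _]addn0 -addn2 eqn_add2l.
  by rewrite -[X in X == _]addn2 -[X in _ == X]addn1 eqn_add2l.
- by move/rcons_inj => -[].
Qed.

Lemma edge_nonisolated C u v : A C u v -> nonisolated A C u && nonisolated A C v.
Proof.
move=> a; apply/andP; split; apply/existsP; first by exists v.
by exists u; rewrite A_sym.
Qed.

Local Notation X := (additive_product A v1).
Local Notation Y := (vert X).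

Definition vtype (y : Y) : 'I_n := last_type (val y).

(** The default value [y] only occurs when [y] or [u] is isolated in the atom
    [C]. *)
Definition vmove C (y : Y) u : Y := insubd y (str_move C (val y) u).
Definition vadj (y z : Y) : bool :=
  [exists C, A C (vtype y) (vtype z) && (z == vmove C y (vtype z))].

Lemma val_vmove C y u : nonisolated A C (vtype y) -> nonisolated A C u ->
  val (vmove C y u) = str_move C (val y) u.
Proof. by move=> ny nu; rewrite val_insubd valid_move //; exact: valP. Qed.

Lemma vtype_move C y u : nonisolated A C (vtype y) -> nonisolated A C u ->
  vtype (vmove C y u) = u.
Proof. by move=> ny nu; rewrite /vtype val_vmove // last_type_move. Qed.

Lemma vmove_id C y : vmove C y (vtype y) = y.
Proof. by apply: val_inj; rewrite val_insubd str_move_id ?if_same //; exact: valP. Qed.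

Lemma vmove_move C y u w : nonisolated A C (vtype y) -> nonisolated A C u ->
  nonisolated A C w -> vmove C (vmove C y u) w = vmove C y w.
Proof.
move=> ny nu nw; apply: val_inj; rewrite !val_vmove ?vtype_move //.
by rewrite str_move_move //; exact: valP.
Qed.

Lemma vmove_inj C C' y u u' : A C (vtype y) u -> A C' (vtype y) u' ->
  vmove C y u = vmove C' y u' -> C = C' /\ u = u'.
Proof.
move=> a a'; have [/andP[n1 n2] /andP[n1' n2']] :=
  (edge_nonisolated a, edge_nonisolated a').
move=> e; split; last by rewrite -(vtype_move n1 n2) e vtype_move.
move/(congr1 val): e; rewrite !val_vmove //; apply: str_move_inj; first exact: valP.
by apply: contraTneq a => ->; rewrite A_irr.
Qed.

Lemma vadj_move C y u : A C (vtype y) u -> vadj y (vmove C y u).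
Proof.
move=> a; have /andP[n1 n2] := edge_nonisolated a.
by apply/existsP; exists C; rewrite vtype_move // a eqxx.
Qed.

Lemma vadjP y z : reflect (exists2 p : letter,
  A p.1 (vtype y) p.2 & z = vmove p.1 y p.2) (vadj y z).
Proof.
apply: (iffP existsP) => [[C /andP[a /eqP e]]|[[C u] /= a ->]].
  by exists (C, vtype z).
have /andP[n1 n2] := edge_nonisolated a.
by exists C; rewrite vtype_move // a eqxx.
Qed.

Lemma vadj_sym : symmetric vadj.
Proof.
suff imp y z : vadj y z -> vadj z y by move=> y z; apply/idP/idP; exact: imp.
move/vadjP=> [[C u] /= a ->]; have /andP[n1 n2] := edge_nonisolated a.
by apply/existsP; exists C;
  rewrite vtype_move // A_sym a /= vmove_move // vmove_id eqxx.
Qed.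

Lemma vadj_irr : irreflexive vadj.
Proof.
move=> y; apply/negbTE/negP => /vadjP h; case: h => -[C u] /= a e;
  have /andP[n1 n2] := edge_nonisolated a.
by move: a; rewrite [in vtype y]e vtype_move // A_irr.
Qed.

Lemma product_edge_vadj (y z : Y) :
  product_edge A v1 (val y) (val z) -> vadj y z.
Proof.
have H s t : valid A None v1 s -> valid A None v1 t -> product_edge A v1 s t ->
    exists2 C, A C (last_type s) (last_type t) & t = str_move C s (last_type t);
      last first.
  move=> pe; have [C a e] := H _ _ (valP y) (valP z) pe.
  have /andP[n1 n2] := edge_nonisolated a.
  by apply/existsP; exists C; rewrite /vtype a /=; apply/eqP/val_inj; rewrite val_vmove.
move=> vs vt pe; case: pe vs vt => {s t} [s C u v a _|s C u C' v a _|C v a _].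
- rewrite valid_rcons => /andP[_ /and4P[_ sv _ _]]; exists C;
    rewrite !last_type_rcons //.
  by rewrite str_move_base eq_sym (negPf sv).
- rewrite valid_rcons => /andP[_ /and4P[cc' uv _ _]]; exists C';
    rewrite !last_type_rcons //.
  by rewrite str_move_ext // last_type_rcons eq_sym -(last_type_rcons s C u) (negPf uv).
- rewrite (valid_rcons None v1 [::]) /= => /and3P[uv _ _].
  exists C => //; rewrite str_move_nil [v == _]eq_sym.
  by rewrite (negPf uv).
Qed.

Lemma vadj_product_edge (y z : Y) : vadj y z ->
  product_edge A v1 (val y) (val z) \/ product_edge A v1 (val z) (val y).
Proof.
move/vadjP=> [[C u] /= a ->]; have /andP[n1 n2] := edge_nonisolated a.
rewrite val_vmove //; have := valP y; rewrite /= => vs; move: a vs {n1}.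
rewrite /vtype /=; case: y => s /= _ a vs.
have us : u != last_type s by apply: contraTneq a => ->; rewrite A_irr.
have [b vb [bC [eb|[w [eb bw nb nw]]]]] := str_base C vs.
  move: a us; rewrite eb str_move_ext // => a us; rewrite (negPf us); left.
  case/lastP: {s vs eb vb bC} b a {us} => [|s [D w]] a.
    exact: EdgeRoot.
  by apply: EdgeChild; rewrite last_type_rcons in a.
rewrite eb str_move_base; move: a; rewrite eb last_type_rcons => a.
case: eqP => [ub|_]; last by left; apply: EdgeSibling.
right; rewrite A_sym ub in a.
case/lastP: {s us vs eb vb nb bC bw ub} b a => [|s [D z0]] a; first exact: EdgeRoot.
by apply: EdgeChild; rewrite last_type_rcons in a.
Qed.

End Strings.

(** * Walks and the spectral radius *)

Lemma set2_eq (T : Type) (a b c d : T) : [set a; b]%classic = [set c; d]%classic ->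
  (a = c /\ b = d) \/ (a = d /\ b = c).
Proof.
move=> e; have : [set c; d]%classic a by rewrite -e; left.
have : [set c; d]%classic b by rewrite -e; right.
have : [set a; b]%classic c by rewrite e; left.
have : [set a; b]%classic d by rewrite e; right.
by move=> /= [] -> [] -> [] ? [] ?; subst; auto.
Qed.

Lemma expr_unbounded (R : archiRealFieldType) (B q : R) : 1 < q -> exists t, B < q ^+ t.
Proof.
move=> q1; have h0 : 0 < q - 1 by rewrite subr_gt0.
have bern t : 1 + t%:R * (q - 1) <= q ^+ t.
  elim: t => [|t IH]; first by rewrite mul0r addr0.
  rewrite exprS; apply: le_trans (ler_wpM2l _ IH);
    last by rewrite (le_trans ler01) ?ltW.
  rewrite -subr_ge0 [X in 0 <= X](_ : _ = t%:R * (q - 1) ^+ 2);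
    last by rewrite -natr1; ring.
  by rewrite mulr_ge0 // sqr_ge0.
exists (Num.bound `|B / (q - 1)|); apply: lt_le_trans (bern _).
rewrite ltr_wpDl // -ltr_pdivrMr //.
apply: le_lt_trans (ler_norm _) _; exact: archi_boundP (normr_ge0 _).
Qed.

Section Walks.
Local Open Scope classical_set_scope.
Variable X : mgraph.
Implicit Types (u v w : vert X) (s : seq (edge X * vert X)).

Lemma walk_cat u v w s t : walk u s v -> walk v t w -> walk u (s ++ t) w.
Proof.
elim: s u => [|[e a] s IH] u /=; first by move->.
by move=> [-> sv] vt; split=> //; exact: IH vt.
Qed.

Lemma walk_sym u v s : walk u s v -> exists t, walk v t u.
Proof.
elim: s u => [|[e a] s IH] u /=; first by move->; exists [::].
move=> [E /IH[t vt]]; exists (t ++ [:: (e, u)]); apply: walk_cat vt _.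
by split => //; rewrite E setUC.
Qed.

Hypothesis loc_fin : forall u,
  finite_set [set p : edge X * vert X | ends p.1 = [set u; p.2]].

Lemma finite_walks t u v : finite_set [set s | size s = t /\ walk u s v].
Proof.
elim: t u => [|t IH] u.
  by apply: (@sub_finite_set _ _ [set [::]]) => // s [/size0nil ->].
apply: (@sub_finite_set _ _
  (\bigcup_(p in [set p : edge X * vert X | ends p.1 = [set u; p.2]])
   (cons p @` [set s | size s = t /\ walk p.2 s v]))).
  move=> [|[e w] s] [//= [st]] [E ws]; exists (e, w) => //=.
  by exists s.
by apply: bigcup_finite => // p _; apply: finite_image; exact: IH.
Qed.

Lemma uniq_le_nwalks t u v (l : seq (seq (edge X * vert X))) : uniq l ->
  (forall s, s \in l -> size s = t /\ walk u s v) -> (size l <= nwalks t u v)%N.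
Proof.
move=> ul lP; rewrite /nwalks -(undup_id ul) -card_fseq.
apply: fsubset_leq_card; apply/fsubsetP => s; rewrite in_fset_set ?inE //=;
  last exact: finite_walks.
by move=> /lP.
Qed.

(** This makes the growth of walks independent of the endpoints. *)
Lemma nwalks_extend u v u' v' a b t : walk u a u' -> walk v' b v ->
  (nwalks t u' v' <= nwalks (size a + t + size b) u v)%N.
Proof.
move=> ua vb; have f1 := finite_walks t u' v'.
set F := [fset (a ++ s ++ b) | s in fset_set [set s | size s = t /\ walk u' s v']]%fset.
have -> : nwalks t u' v' = #|` F|.
  rewrite /nwalks card_imfset //= => s s' /eqP; rewrite eqseq_cat // eqxx /= => /eqP e.
  have /eqP := congr1 size e; rewrite !size_cat eqn_add2r => /eqP es.
  by move/eqP: e; rewrite eqseq_cat // => /andP[/eqP].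
apply: fsubset_leq_card; apply/fsubsetP => s /imfsetP[s' /=].
rewrite in_fset_set // inE /= => -[st ws'] ->; rewrite in_fset_set;
  last exact: finite_walks.
rewrite inE /=; split; first by rewrite !size_cat st addnA.
by apply: walk_cat ua _; apply: walk_cat ws' vb.
Qed.

Lemma walk_growth_ge0 (R : realType) u v : (0 <= walk_growth R u v)%E.
Proof.
by apply: limf_esup_ge0 => [|t]; rewrite ?lee_fin ?powR_ge0.
Qed.

(** A limit superior below [y] bounds all but finitely many terms. *)
Lemma nwalks_bound (R : realType) u v (y : R) : 0 < y -> (walk_growth R u v < y%:E)%E ->
  exists N, forall t, (N <= t)%N -> (nwalks t u v)%:R <= y ^+ t.
Proof.
move=> y0 /ereal_inf_lt[_ [U [N _ NU] <-]] Uy; exists N.+1 => t Nt.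
have t0 : t%:R != 0 :> R by rewrite pnatr_eq0 -lt0n (leq_trans _ Nt).
have : ((((nwalks t u v)%:R : R) `^ (t%:R^-1))%:E <= y%:E)%E.
  apply: le_trans (ltW Uy); apply: ereal_sup_ubound; exists t => //.
  by apply: NU; apply: ltnW.
rewrite lee_fin => le.
have -> : (nwalks t u v)%:R = ((nwalks t u v)%:R `^ (t%:R^-1)) ^+ t :> R.
  by rewrite -powR_mulrn ?powR_ge0 // -powRrM mulVf // powRr1.
by apply: lerXn2r; rewrite ?nnegrE ?powR_ge0 ?(ltW y0).
Qed.

End Walks.

Section StringGraph.
Local Open Scope classical_set_scope.
Variables (n c : nat) (A : 'I_c -> rel 'I_n) (v1 : 'I_n).
Hypotheses (A_sym : forall j, symmetric (A j)) (A_irr : forall j, irreflexive (A j)).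
Hypothesis atom_conn : forall j, connected_graph (underline A j).
Local Notation X := (additive_product A v1).
Local Notation Y := (vert X).
Local Notation adj := (@vadj n c A v1).

Lemma edgeX_ex (e : edge X) : exists y z : Y, adj y z /\ ends e = [set y; z].
Proof.
case: e => e /= /[dup] /set_mem [y [z [pe ee]]] he; exists y, z; split => //.
exact: product_edge_vadj.
Qed.

Lemma edgeX_mk (y z : Y) : adj y z -> exists e : edge X, ends e = [set y; z].
Proof.
move=> /(vadj_product_edge A_sym A_irr) yz.
have h : [set y; z] \in simple_edges (fun s t : Y => product_edge A v1 (val s) (val t)).
  apply/mem_set; case: yz => [yz|zy]; first by exists y, z.
  by exists z, y; rewrite setUC.
by exists (exist (fun x : set Y => x \in _) _ h).
Qed.

Lemma endsX_inj : injective (@ends X).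
Proof. by move=> e e' ee; apply: val_inj. Qed.

Lemma endsX_adj (e : edge X) (y z : Y) : ends e = [set y; z] -> adj y z.
Proof.
have [y' [z' [a ->]]] := edgeX_ex e.
by move=> e2; case: (set2_eq e2) => -[<- <-] //; rewrite (vadj_sym A_sym).
Qed.

Lemma loc_finX (y : Y) : finite_set [set p : edge X * Y | ends p.1 = [set y; p.2]].
Proof.
have [e0|/forallNP noe] := pselect (exists e : edge X, True); last first.
  by apply: (@sub_finite_set _ _ set0) => // -[e w] _; apply: (noe e).
case: e0 => e0 _.
pose f (w : Y) : edge X * Y := (xget e0 [set e | ends e = [set y; w]], w).
pose B := f @` ((fun p : 'I_c * 'I_n => vmove p.1 y p.2) @` setT).
suff sub : [set p : edge X * Y | ends p.1 = [set y; p.2]] `<=` B.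
  by apply: (sub_finite_set sub); do 2!apply: finite_image; exact: finite_finset.
move=> [e w] /= ee; have := endsX_adj ee => /(vadjP A_sym)[p ap wE].
exists w; first by exists p.
rewrite /f; congr (_, _); apply: endsX_inj; apply: etrans (esym ee).
exact: (@xgetPex _ e0 [set e | ends e = [set y; w]] (ex_intro _ e ee)).
Qed.


Lemma adj_walk (y z : Y) : adj y z -> exists s, walk y s z.
Proof. by move=> /edgeX_mk[e ee]; exists [:: (e, z)]. Qed.

Lemma atom_walk j s (a b : vert (underline A j)) (y : Y) : vtype y = val a ->
  walk a s b -> exists s', walk y s' (vmove j y (val b)).
Proof.
elim: s a y => [|[e w] s IH] a y ya /=.
  by move=> <-; rewrite -ya vmove_id; exists [::].
move=> [E wb]; have aw : A j (val a) (val w).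
  case: e E => e /= /set_mem [u [v [uv ->]]] E.
  by case: (set2_eq E) => -[<- <-] //; rewrite A_sym.
have nb := valP b; have nw := valP w; have na := valP a.
have := IH w (vmove j y (val w)); rewrite vtype_move ?ya // => /(_ erefl wb)[s1 ws1].
have [s2 ws2] : exists s, walk y s (vmove j y (val w)).
  by apply: adj_walk; apply: vadj_move => //; rewrite ya.
exists (s2 ++ s1); apply: walk_cat ws2 _; move: ws1; rewrite vmove_move ?ya //.
Qed.

Lemma vmove_walk j (y : Y) u : nonisolated A j (vtype y) -> nonisolated A j u ->
  exists s, walk y s (vmove j y u).
Proof.
move=> ny nu; pose mk := exist (fun u => nonisolated A j u) : forall u, _ ->
  vert (underline A j).
have [_ /(_ (mk _ ny) (mk _ nu))[s ws]] := atom_conn j.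
exact: (atom_walk _ ws).
Qed.

Definition rootY : Y := exist (fun s => valid A None v1 s) [::] isT.

Lemma connX (y z : Y) : exists s, walk y s z.
Proof.
suff root_conn (y' : Y) : exists s, walk rootY s y'.
  have [s /walk_sym[s' ws]] := root_conn y; have [t wt] := root_conn z.
  by exists (s' ++ t); apply: walk_cat ws wt.
case: y' => s; elim/last_ind: s => [|s [C u] IH] vs.
  by exists [::] => /=; apply: val_inj.
have := vs; rewrite valid_rcons => /andP[vs' /and4P[lC tu nt nu]].
pose p : Y := exist (fun s => valid A None v1 s) s vs'.
have [t wt] := IH vs'; have [t' wt'] := @vmove_walk C p u nt nu.
exists (t ++ t'); apply: walk_cat wt _.
have <- : vmove C p u = exist (fun s => valid A None v1 s) (rcons s (C, u)) vs :> Y;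
  last by [].
by apply: val_inj; rewrite val_vmove // str_move_ext //= eq_sym (negPf tu).
Qed.

Lemma rho_growth (R : realType) : exists u v : Y, rho R X = walk_growth R u v.
Proof.
rewrite /rho; case: xgetP => [r _ [u [v ->]]|/(_ (walk_growth R rootY rootY)) []].
  by exists u, v.
by exists rootY, rootY.
Qed.

Lemma rho_ge0 (R : realType) : (0 <= rho R X)%E.
Proof. by have [u [v ->]] := rho_growth R; apply: walk_growth_ge0. Qed.

Lemma nwalks_rho (R : realType) (y : R) (u v : Y) : 0 < y -> (rho R X < y%:E)%E ->
  exists K N, forall t, (N <= t)%N -> (nwalks t u v)%:R <= K * y ^+ t.
Proof.
move=> y0; have [u0 [v0 ->]] := rho_growth R => /(nwalks_bound y0)[N HN].
have [a wa] := connX u0 u; have [b wb] := connX v v0.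
exists (y ^+ (size a + size b)), N => t Nt; rewrite -exprD.
apply: le_trans (_ : (nwalks (size a + t + size b) u0 v0)%:R <= _).
  by rewrite ler_nat; apply: nwalks_extend wa wb; exact: loc_finX.
rewrite addnAC; apply: HN; rewrite (leq_trans Nt) // leq_addl //.
Qed.

Section FiniteSub.
Variables (W : finType) (iota : W -> Y).
Hypothesis iota_inj : injective iota.
Let e : rel W := relpre iota adj.

Fixpoint npaths t (i j : W) : nat :=
  if t is t'.+1 then \sum_(k | e i k) npaths t' k j else (i == j)%N.

(** Paths in the finite subgraph are numbered by vertices and walks by edges and
    vertices; a choice of edges makes one into the other injectively. *)
Lemma npaths_le t i j : (npaths t i j <= nwalks t (iota i) (iota j))%N.
Proof.
suff [l [ul <- lP]] : exists l : seq (seq (edge X * Y)),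
  [/\ uniq l, size l = npaths t i j &
    forall s, s \in l -> size s = t /\ walk (iota i) s (iota j)].
  by apply: uniq_le_nwalks => //; exact: loc_finX.
elim: t i => [|t IH] i /=.
  have [->|ij] := eqVneq i j; last by exists [::].
  by exists [:: [::]]; split => // s; rewrite inE => /eqP->.
have [k0 eik0|no] := pickP (e i); last first.
  by exists [::]; split => //; rewrite big_pred0.
have [l /all_and3[ul sl lP]] := choice IH.
have edg k : exists p : edge X * Y, e i k ->
  ends p.1 = [set iota i; p.2] /\ p.2 = iota k.
  have [eik|_] := boolP (e i k).
    by have [ed edE] := edgeX_mk eik; exists (ed, iota k).
  by have [ed _] := edgeX_mk eik0; exists (ed, iota k).
have [f fP] := choice edg.
exists [seq f k :: s | k <- enum (e i), s <- l k]; split.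
- apply: allpairs_uniq_dep => [|k _|]; rewrite ?enum_uniq //.
  move=> _ _ /allpairsPdep[k [s [kP sP ->]]] /allpairsPdep[k' [s' [kP' sP' ->]]] /=.
  rewrite !mem_enum in kP kP' => -[fk ->].
  have [_ f1] := fP k kP; have [_ f2] := fP k' kP'.
  by have -> : k = k' by apply: iota_inj; rewrite -f1 fk f2.
- rewrite size_allpairs_dep sumnE big_map big_enum /=.
  by apply: eq_bigr => k _; rewrite sl.
- move=> _ /allpairsPdep[k [s [kP sP ->]]]; have [st ws] := lP k s sP.
  rewrite mem_enum in kP; have [fe fk] := fP k kP.
  split; first by rewrite /= st.
  rewrite /=; case: (f k) fe fk => ed w /= fe fk; split => //; by rewrite fk.
Qed.

(** A zero [x > r] of the minor yields a vector [y] with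
    [x |y_w| <= sum_(k ~ w) |y_k|]; iterating, [x ^ t] is bounded by a multiple of
    the number of walks of length [t], which grows slower.  Having no zero above
    [r], the minor has the sign of its leading coefficient there. *)
Lemma adj_minor_gt0_of_rho (R : realType) (x : R) (T : {set W}) :
  (rho R X < x%:E)%E -> 0 < adj_minor e x T.
Proof.
pose P := minor T (fun v w => (v == w)%:R * 'X - ((e v w)%:R : R)%:P).
have PE t : P.[t] = adj_minor e t T.
  rewrite -[LHS]/(horner_eval t P) minor_morph; apply: eq_minor => v w _ _.
  by rewrite /= /horner_eval /adj_char hornerD hornerN hornerM hornerX hornerC
    hornerMn hornerC.
have rho0 := rho_ge0 R; case E : (rho R X) rho0 => [r| |] // r0.
rewrite lte_fin lee_fin in r0 * => rx; rewrite -PE.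
apply: (@lead_coef_noroot_gt0 _ _ r) rx.
  by rewrite /P minor_charpoly (monicP (char_poly_monic _)) ltr01.
move=> {x} x rx; rewrite PE; apply/negP=> /eqP/minor_kernel[y [[v0 yv0] yN colE]].
have x0 : 0 < x by apply: le_lt_trans rx.
have eS : symmetric e by move=> a b; exact: vadj_sym.
have step w : x * `|y w| <= \sum_(k | e w k) `|y k|.
  have [wT|wT] := boolP (w \in T); last first.
    by rewrite (yN w wT) normr0 mulr0 sumr_ge0.
  have -> : x * `|y w| = `|\sum_(v in T | e w v) y v|.
    rewrite -[in LHS](gtr0_norm x0) -normrM; congr `|_|.
    have := colE w wT; under eq_bigr => v vT do rewrite /adj_char mulrBr.
    rewrite sumrB => /eqP; rewrite subr_eq0 => /eqP e1.
    have -> : x * y w = \sum_(v in T) y v * ((v == w)%:R * x).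
      rewrite (bigD1 w) //= eqxx mul1r big1 ?addr0 1?mulrC // => v /andP[_ /negPf->].
      by rewrite mul0r mulr0.
    rewrite e1 [LHS](bigID (e w)) /= [X in _ + X]big1 ?addr0 => [|v /andP[_]].
      by apply: eq_bigr => v /andP[_ wv]; rewrite eS wv mulr1.
    by rewrite eS => /negPf->; rewrite mulr0.
  apply: le_trans (ler_norm_sum _ _ _) _.
  by rewrite [leRHS](bigID (mem T)) /= [X in X +
    _](eq_bigl (fun v => (v \in T) && e w v)) ?lerDl ?sumr_ge0 // => v; rewrite andbC.
have iter t w : x ^+ t * `|y w| <= \sum_v (npaths t w v)%:R * `|y v|.
  elim: t w => [|t IH] w.
    by rewrite expr0 mul1r (bigD1 w) //= eqxx mul1r lerDl sumr_ge0 //.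
  rewrite exprSr -mulrA.
  apply: le_trans (ler_wpM2l _ (step w)) _; first by rewrite exprn_ge0 // ltW.
  rewrite mulr_sumr /=; apply: le_trans (ler_sum _ (fun k _ => IH k)) _.
  rewrite exchange_big /=; apply: ler_sum => v _.
  by rewrite natr_sum mulr_suml.
have yw w : y w = 0.
  apply/eqP; rewrite -normr_eq0 -[_ == _]negbK; apply/negP=> yw.
  have {yw} yw : 0 < `|y w| by rewrite lt_def yw normr_ge0.
  pose m := (r + x) / 2.
  have rm : r < m by rewrite midf_lt.
  have mx : m < x by rewrite midf_lt.
  have m0 : 0 < m by apply: le_lt_trans rm.
  have bnd v : exists KN : R * nat, forall t, (KN.2 <= t)%N ->
    (nwalks t (iota w) (iota v))%:R <= KN.1 * m ^+ t.
    have [K [N H]] := @nwalks_rho R m (iota w) (iota v) m0 ltac:(by rewrite E lte_fin).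
    by exists (K, N).
  have [f fP] := choice bnd.
  pose C := \sum_v (f v).1 * `|y v|.
  pose N := \max_v (f v).2.
  have bd t : (N <= t)%N -> (x / m) ^+ t <= C / `|y w|.
    move=> Nt; rewrite ler_pdivlMr // expr_div_n mulrAC ler_pdivrMr ?exprn_gt0 //.
    apply: le_trans (iter t w) _; rewrite /C mulr_suml; apply: ler_sum => v _.
    rewrite mulrAC ler_wpM2r //; apply: le_trans (fP v t _).
      by rewrite ler_nat npaths_le.
    by apply: leq_trans Nt; apply: leq_bigmax.
  have q1 : 1 < x / m by rewrite ltr_pdivlMr // mul1r.
  have [t Ct] := expr_unbounded (C / `|y w|) q1.
  have := bd (N + t)%N (leq_addr _ _); apply/negP; rewrite -ltNge.
  apply: lt_le_trans Ct _; rewrite exprD ler_peMl ?exprn_ge0 ?exprn_ege1 ?ltW //.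
  exact: lt_trans q1.
by case/eqP: yv0.
Qed.
End FiniteSub.

End StringGraph.

(** * Atlases, the quotients of the additive product *)

(** A possibly disconnected quotient of the additive product, seen as a graph tiled
    by copies of atoms: [amv C v u] is the vertex of type [u] in the copy of the
    atom [C] through [v]. *)
Record atlas (n c : nat) := Atlas {
  avert : finType;
  aty : avert -> 'I_n;
  amv : 'I_c -> avert -> 'I_n -> avert;
  aty_mv : forall C v u, aty (amv C v u) = u;
  amv_id : forall C v, amv C v (aty v) = v;
  amv_mv : forall C v u w, amv C (amv C v u) w = amv C v w }.

Section AtlasTheory.
Variables (n c : nat) (A : 'I_c -> rel 'I_n) (v1 : 'I_n).
Hypotheses (A_sym : forall j, symmetric (A j)) (A_irr : forall j, irreflexive (A j)).
Variable (V : atlas n c).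
Local Notation X := (additive_product A v1).
Local Notation Y := (vert X).
Implicit Types (v w : avert V) (C : 'I_c).

Definition atom_adj C v w : bool := A C (aty v) (aty w) && (w == amv C v (aty w)).

Lemma atom_adj_sym C : symmetric (atom_adj C).
Proof.
suff imp v w : atom_adj C v w -> atom_adj C w v by move=> v w; apply/idP/idP;
  exact: imp.
move=> /andP[a /eqP e]; rewrite /atom_adj A_sym a /= e amv_mv amv_id.
by rewrite eqxx.
Qed.

Lemma atom_adj_irr C : irreflexive (atom_adj C).
Proof. by move=> v; rewrite /atom_adj A_irr. Qed.

(** The covering map from the additive product that sends the root to [v0]: a
    string is a sequence of moves. *)
Definition unfold (v0 : avert V) (y : Y) : avert V :=
  foldl (fun v p => amv p.1 v p.2) v0 (val y).

Variable v0 : avert V.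
Hypothesis v0_ty : aty v0 = v1.

Lemma aty_unfold y : aty (unfold v0 y) = vtype y.
Proof.
rewrite /unfold /vtype; case: y => s /= _; case/lastP: s => [|s [C u]] //.
by rewrite -cats1 foldl_cat /= aty_mv cats1 last_type_rcons.
Qed.

Lemma unfold_move C y u : nonisolated A C (vtype y) -> nonisolated A C u ->
  unfold v0 (vmove C y u) = amv C (unfold v0 y) u.
Proof.
move=> ny nu; rewrite {1}/unfold val_vmove // /unfold.
have vy := valP y; have ty_s s : aty (foldl (fun v p => amv p.1 v p.2) v0 s) =
  last_type v1 s.
  case/lastP: s => [|s [D w]] //.
  by rewrite -cats1 foldl_cat /= aty_mv cats1 last_type_rcons.
have fr (s : seq ('I_c * 'I_n)) D (w : 'I_n) : foldl (fun v p =>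
  amv p.1 v p.2) v0 (rcons s (D, w)) =
    amv D (foldl (fun v p => amv p.1 v p.2) v0 s) w.
  by rewrite -cats1 foldl_cat.
have [b vb [bC [->|[w [-> bw _ _]]]]] := str_base C vy.
  rewrite str_move_ext //; case: eqP => [->|_]; last by rewrite fr.
  by rewrite -ty_s amv_id.
rewrite str_move_base fr amv_mv; case: eqP => [->|_]; last by rewrite fr.
by rewrite -ty_s amv_id.
Qed.

End AtlasTheory.

Section Reach.
Variables (n c : nat) (A : 'I_c -> rel 'I_n) (v1 : 'I_n).
Hypotheses (A_sym : forall j, symmetric (A j)) (A_irr : forall j, irreflexive (A j)).
Hypothesis sum_conn : connected_graph (sum_graph A).
Variable (V : atlas n c).
Local Notation X := (additive_product A v1).
Local Notation Y := (vert X).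

(** A walk in the sum graph from the type of [v] to [v1] lifts to the atlas; its
    end point serves as the image of the root, and the reversed walk is followed
    in the additive product. *)
Lemma unfold_reach (v : avert V) : exists2 v0, aty v0 = v1 &
  exists y : Y, unfold v0 y = v.
Proof.
have [_ /(_ (aty v) v1)[s]] := sum_conn.
move E : (aty v) => a ws; elim: s a v E ws => [|[e w] s IH] a v /= va.
  move=> av1; exists v; first by rewrite va.
  by exists (rootY A v1).
move=> [Ee ws].
have [C aw] : exists C, A C a w.
  case: e Ee => e /= /set_mem [u [z [uz ->]]] E; exists e.1.
  by case: (set2_eq E) => -[<- <-] //; rewrite A_sym.
have [v0 v0t [y yE]] := IH w (amv C v w) (aty_mv _ _ _) ws; exists v0 => //.
have /andP[na nw] := edge_nonisolated A_sym aw.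
exists (vmove C y a); rewrite unfold_move // -?(aty_unfold v0t) yE ?aty_mv //.
by rewrite amv_mv -va amv_id.
Qed.

Lemma ball_finite (m : nat) (y : Y) : exists ts : seq Y, forall p,
  path (@vadj n c A v1) y p -> (size p <= m)%N -> {subset p <= ts}.
Proof.
elim: m y => [|m IH] y; first by exists [::] => -[].
have [ts tsP] := choice IH.
exists (flatten [seq z :: ts z | z <- [seq vmove p.1 y p.2 | p : 'I_c * 'I_n]]).
move=> [|z p] //= /andP[yz zp]; rewrite ltnS => pm t tp.
apply/flattenP; exists (z :: ts z); last first.
  by move: tp; rewrite !inE => /orP[->//|/(tsP z p zp pm) ->]; rewrite orbT.
apply/mapP; exists z => //; have /vadjP[//|q _ ->] := yz.
by apply/mapP; exists q; rewrite // mem_enum.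
Qed.

Hypothesis atom_conn : forall j, connected_graph (underline A j).

(** Vertices are added to [S] one by one.  For the new vertex [u], a lift of [u]
    together with a ball around it of radius the number of vertices is a finite
    set to which [compare_ind] applies. *)
Theorem signsum_minor_gt0 (R : realType) (q0 : {ffun 'I_c * avert V -> bool}) (x : R)
    (S : {set avert V}) : (rho R X < x%:E)%E ->
  0 < signsum_minor (atom_adj A (V := V)) (enum {: 'I_c * avert V}) q0 S x.
Proof.
move=> rx; have [m] := ubnP #|S|; elim: m S => // m IH S; rewrite ltnS => cS.
have [->|[u uS]] := set_0Vmem S.
  rewrite /signsum_minor; move: (enum _) => l; move: q0 {IH} => q.
  by elim: l q => [|i l IHl] q /=; rewrite ?minor0 ?ltr01 ?addr_gt0.
have [v0 v0t [y yE]] := unfold_reach u.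
have [ts tsP] := ball_finite #|avert V| y.
pose W : finType := seq_sub (y :: ts).
pose iota : W -> Y := val.
have iota_inj : injective iota by exact: val_inj.
pose yW : W := SeqSub (mem_head y ts).
pose copy C (y z : Y) := [/\ nonisolated A C (vtype y),
  nonisolated A C (vtype z) & z = vmove C y (vtype z)].
have kS (S' : {set avert V}) : (#|S'| <= #|S :\ u|)%N ->
    0 < signsum_minor (atom_adj A (V := V)) (enum {: 'I_c * avert V}) q0 S' x.
  move=> le; apply: IH; apply: leq_ltn_trans le _.
  by move: cS; rewrite (cardsD1 u S) uS.
have atom_adjE C (z : Y) v : atom_adj A C (unfold v0 z) v ->
    [/\ A C (vtype z) (aty v), v = amv C (unfold v0 z) (aty v),
        nonisolated A C (vtype z) & nonisolated A C (aty v)].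
  by move=> /andP[a /eqP e]; rewrite (aty_unfold v0t) in a;
    have /andP[] := edge_nonisolated A_sym a.
have lift_pi C (z : Y) v : atom_adj A C (unfold v0 z) v ->
  unfold v0 (vmove C z (aty v)) = v.
  by move=> /atom_adjE[a e nz nv]; rewrite unfold_move -?e.
have lift_inj C C' (z : Y) v v' : atom_adj A C (unfold v0 z) v ->
  atom_adj A C' (unfold v0 z) v' ->
    vmove C z (aty v) = vmove C' z (aty v') -> C = C'.
  by move=> /atom_adjE[a _ _ _] /atom_adjE[a' _ _ _] /(vmove_inj A_sym A_irr a a')[].
have lift_copy C (z : Y) v : atom_adj A C (unfold v0 z) v ->
  copy C z (vmove C z (aty v)).
  by move=> /atom_adjE[a e nz nv]; split; rewrite ?vtype_move.
have copy_sym C y1 y2 : copy C y1 y2 -> copy C y2 y1.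
  by move=> [n1 n2 e]; split=> //; rewrite e vmove_move ?vmove_id // -e.
have copy_trans C y1 y2 y3 : copy C y1 y2 -> copy C y2 y3 -> copy C y1 y3.
  by move=> [n1 n2 e] [_ n3 e3]; split=> //; rewrite {1}e3 e vmove_move // -e.
have copy_edge C y1 y2 : copy C y1 y2 -> atom_adj A C (unfold v0 y1) (unfold v0 y2) ->
    vadj y1 y2.
  move=> [n1 n2 e] /atom_adjE[a _ _ _]; rewrite (aty_unfold v0t) in a.
  by rewrite e; apply: vadj_move.
have phi0 T : 0 < adj_minor (relpre iota (@vadj n c A v1)) x T.
  exact: adj_minor_gt0_of_rho.
have eirr : irreflexive (relpre iota (@vadj n c A v1)).
  by move=> w; apply: vadj_irr.
have [cmp _] := compare_ind (atom_adj_irr A_irr (V := V)) (fun i => mem_enum _ i)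
  lift_pi lift_inj lift_copy copy_sym copy_trans copy_edge iota_inj eirr phi0 kS
    (leqnn _).
have yWE : unfold v0 (iota yW) = u by rewrite yE.
have := cmp [set~ yW] yW; rewrite yWE finset.setD1K // => H.
have {}H : adj_minor (relpre iota (@vadj n c A v1)) x (yW |: [set~ yW]) *
    signsum_minor (atom_adj A (V := V)) (enum {: 'I_c * avert V}) q0 (S :\ u) x <=
    signsum_minor (atom_adj A (V := V)) (enum {: 'I_c * avert V}) q0 S x *
    adj_minor (relpre iota (@vadj n c A v1)) x [set~ yW].
  apply: H; rewrite ?inE ?eqxx //.
  move=> p yp up Sp; apply/allP=> z zp.
  have zts : z \in ts.
    apply: (tsP p yp _ z zp); rewrite -(size_map (unfold v0)).
    by rewrite -(card_uniqP up) max_card.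
  have zin : z \in y :: ts by rewrite inE zts orbT.
  apply/exists_inP; exists (SeqSub zin) => //; rewrite !inE.
  have /andP[_ zy] := allP Sp z zp.
  by apply: contraNneq zy => /(congr1 val) /= ->.
rewrite -(pmulr_lgt0 _ (phi0 [set~ yW])); apply: lt_le_trans H.
by rewrite mulr_gt0 // kS.
Qed.
End Reach.

(** * Two-fold lifts *)

(** Adding the second block row to the first one and subtracting the first block
    column from the second one makes the matrix block triangular. *)
Lemma det_block_sym (K : comNzRingType) m (a b : 'M[K]_m) :
  \det (block_mx a b b a) = \det (a + b) * \det (a - b).
Proof.
have <- : \det (block_mx (a + b) 0 b (a - b)) = \det (a + b) * \det (a - b).
  exact: det_lblock.
have -> : block_mx (a + b) 0 b (a - b) =
    block_mx 1%:M 1%:M 0 1%:M *m block_mx a b b a *m block_mx 1%:M (- 1%:M) 0 1%:M.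
  rewrite !mulmx_block !mul1mx !mul0mx !mulmxN !mulmx1 !mulmx0 !addr0 !add0r.
  by congr block_mx; [rewrite [b + a]addrC addNr | rewrite addrC].
by rewrite !det_mulmx !det_ublock !det1 !mul1r !mulr1.
Qed.

Section Lift.
Variables (n c : nat) (A : 'I_c -> rel 'I_n).
Variables (V : atlas n c) (q : {ffun 'I_c * avert V -> bool}).

Let lift_move C (p : avert V * bool) u :=
  (amv C p.1 u, p.2 (+) q (C, p.1) (+) q (C, amv C p.1 u)).

(** The signs move consistently over each copy of an atom, so copies lift to
    copies. *)
Definition lift_atlas : atlas n c.
Proof.
apply: (@Atlas n c (avert V * bool)%type (fun p => aty p.1) lift_move).
- by move=> C [v s] u /=; rewrite aty_mv.
- by move=> C [v s]; rewrite /lift_move /= amv_id addbK.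
- by move=> C [v s] u w; rewrite /lift_move /= amv_mv addbK.
Defined.

Lemma atom_adj_lift C (p p' : avert lift_atlas) : atom_adj A C p p' =
  atom_adj A C p.1 p'.1 && (p'.2 == p.2 (+) q (C, p.1) (+) q (C, p'.1)).
Proof.
case: p p' => v s [w t]; rewrite /atom_adj /= /lift_move xpair_eqE /= -andbA.
by case: (w =P amv C v (aty w)) => [<-|].
Qed.

End Lift.

Section CharPoly.
Variables (R : rcfType) (n c : nat) (A : 'I_c -> rel 'I_n).

Definition adj_mult (V : atlas n c) (v w : avert V) : nat := \sum_C (atom_adj A C v w).

Definition char_entry (V : atlas n c) (v w : avert V) : {poly R} :=
  (v == w)%:R * 'X - ((adj_mult v w)%:R)%:P.

Definition atlas_charpoly (V : atlas n c) : {poly R} := fdet (@char_entry V).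

Lemma atlas_charpoly_minor V : atlas_charpoly V = minor [set: avert V] (@char_entry V).
Proof. by rewrite minorT. Qed.

Lemma minor_char_entry V (S : {set avert V}) : minor S (@char_entry V) =
  char_poly (\matrix_(i < #|S|, j < #|S|) (adj_mult (enum_val i) (enum_val j))%:R).
Proof. exact: (minor_charpoly (fun v w : avert V => (adj_mult v w)%:R)). Qed.

(** Antisymmetric functions on the lift see the signed adjacency matrix,
    symmetric ones the adjacency matrix of [V]. *)
Lemma atlas_charpoly_lift V (q : {ffun 'I_c * avert V -> bool}) :
  atlas_charpoly (lift_atlas q) = atlas_charpoly V *
    signsum_charpoly R (atom_adj A (V := V)) [::] q [set: avert V].
Proof.
pose m := #|avert V|.
pose h (i : 'I_(m + m)) : avert (lift_atlas q) :=
  match fintype.split i with inl a => (enum_val a, false) | inr b =>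
    (enum_val b, true) end.
have injh : injective h.
  move=> i j hij; rewrite -(splitK i) -(splitK j); move: hij; rewrite /h.
  by case: (fintype.split i) => a; case: (fintype.split j) => b // [/enum_val_inj->].
have bh : bijective h.
  by apply: inj_card_bij => //; rewrite card_ord card_prod card_bool muln2 -addnn.
rewrite /atlas_charpoly -(fdet_reindex _ bh).
pose N b : 'M[{poly R}]_m := \matrix_(i, j) ((~~ b && (i == j))%:R * 'X -
  (\sum_C (atom_adj A C (enum_val i) (enum_val j) &&
    (b == q (C, enum_val i) (+) q (C, enum_val j))))%:R%:P).
have -> : \matrix_(i, j) char_entry (h i) (h j) =
  block_mx (N false) (N true) (N true) (N false).
  apply/matrixP=> i j; rewrite -(splitK i) -(splitK j).
  case: (fintype.split i) => a; case: (fintype.split j) => b;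
    rewrite ?block_mxEul ?block_mxEur ?block_mxEdl ?block_mxEdr !mxE;
    rewrite /h ?(unsplitK (inl _)) ?(unsplitK (inr _)) /char_entry xpair_eqE
      ?eqxx ?andbT ?andbF /= ?(inj_eq enum_val_inj) //;
    congr (_ - (_%:R)%:P); apply: eq_bigr => C _; rewrite atom_adj_lift /=;
      congr (nat_of_bool (_ && _)).
  - by case: (q _); case: (q _).
  - by case: (q _); case: (q _).
rewrite det_block_sym; congr (\det _ * _).
  apply/matrixP=> i j; rewrite !mxE /char_entry (inj_eq enum_val_inj) mul0r sub0r.
  rewrite -addrA -opprD -polyCD -natrD -big_split /=; congr (_ - (_%:R)%:P).
  apply: eq_bigr => C _; case: (atom_adj _ _ _ _) => //=.
  by case: (q _ (+) q _).
rewrite /signsum_charpoly /signsum_minor /= minorT; congr (\det _).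
apply/matrixP=> i j; rewrite !mxE /signed_char (inj_eq enum_val_inj) mul0r sub0r opprK.
rewrite -addrA; congr (_ + _);
  rewrite addrC -polyCN -polyCD /signed_adj !natr_sum -sumrB.
rewrite -sumrN raddf_sum; apply: eq_bigr => C _.
case: (atom_adj _ _ _ _); rewrite /= ?subrr ?mul0r ?oppr0 // mul1r /sgb -signr_addb.
by case: (_ (+) _); rewrite ?sub0r ?subr0 ?opprK ?expr0 ?expr1 ?polyCN ?opprK.
Qed.

(** At most [m] roots above [r], counted with multiplicity, in a form that
    multiplies well along a tower of lifts. *)
Definition few_big_roots (r : R) (m : nat) (p : {poly R}) : Prop :=
  exists P Q : {poly R}, [/\ p = P * Q, (size P <= m.+1)%N & forall x, r < x ->
    Q.[x] != 0].

End CharPoly.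

Section Tower.
Variables (R : realType) (n c : nat) (A : 'I_c -> rel 'I_n) (v1 : 'I_n).
Hypotheses (A_sym : forall j, symmetric (A j)) (A_irr : forall j, irreflexive (A j)).
Hypothesis sum_conn : connected_graph (sum_graph A).
Hypothesis atom_conn : forall j, connected_graph (underline A j).
Variable r : R.
Hypothesis rhoE : rho R (additive_product A v1) = r%:E.

Definition base_atlas : atlas n c.
Proof. by apply: (@Atlas n c 'I_n id (fun _ _ u => u)). Defined.

Lemma size_atlas_charpoly (V : atlas n c) : size (atlas_charpoly R A V) = #|avert V|.+1.
Proof. by rewrite atlas_charpoly_minor minor_char_entry size_char_poly cardsT. Qed.

(** Each lift multiplies the characteristic polynomial by one without roots above
    [r], while the base graph contributes degree [n]. *)
Theorem tower (i : nat) : exists V : atlas n c, #|avert V| = (n * 2 ^ i)%N /\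
  few_big_roots r n (atlas_charpoly R A V).
Proof.
elim: i => [|i [V [cV [P [Q [PQ sP Q0]]]]]].
  exists base_atlas; split; first by rewrite card_ord muln1.
  exists (atlas_charpoly R A base_atlas), 1; rewrite mulr1; split => //.
    by rewrite size_atlas_charpoly card_ord.
  by move=> x _; rewrite hornerC oner_eq0.
pose q0 := [ffun _ => false] : {ffun 'I_c * avert V -> bool}.
have [x rx|q qP] := sign_selection (atom_adj_sym A_sym (V := V))
  (atom_adj_irr A_irr (V := V))
    (l := enum {: 'I_c * avert V}) (q := q0) (r := r).
  rewrite horner_signsum_charpoly;
    apply: (signsum_minor_gt0 A_sym A_irr sum_conn atom_conn (v1 := v1)).
  by rewrite rhoE lte_fin.
exists (lift_atlas q); split; first by rewrite card_prod card_bool cV expnSr mulnA.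
exists P, (Q * signsum_charpoly R (atom_adj A (V := V)) [::] q [set: avert V]);
  split => //.
  by rewrite atlas_charpoly_lift PQ mulrA.
by move=> x rx; rewrite hornerM mulf_neq0 ?Q0 // gt_eqF // qP.
Qed.

End Tower.

(** * Components as finite quotients *)

Lemma finset2_eq (T : finType) (a b c d : T) : [set a; b]%SET = [set c; d]%SET ->
  (a = c /\ b = d) \/ (a = d /\ b = c).
Proof.
move=> e; apply: set2_eq; apply/seteqP; split=> x /= H; 
  move: (congr1 (fun Z : {set T} => x \in Z) e); rewrite !finset.in_set2.
  by case: H => ->; rewrite eqxx ?orbT => /esym /orP[/eqP->|/eqP->]; auto.
by case: H => ->; rewrite eqxx ?orbT => /orP[/eqP->|/eqP->]; auto.
Qed.

Lemma walk_image (X Y : mgraph) (fV : vert X -> vert Y) (fE : edge X -> edge Y) :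
  (forall e, ends (fE e) = (fV @` ends e)%classic) ->
  forall s u v, walk u s v -> walk (fV u) [seq (fE p.1, fV p.2) | p <- s] (fV v).
Proof.
move=> fP; elim=> [|[e w] s IH] u v /=; first by move->.
by move=> [E ws]; split; [rewrite fP E image_setU !image_set1|exact: IH].
Qed.

Lemma covers_connected (X Y : mgraph) : covers X Y -> connected_graph X ->
  connected_graph Y.
Proof.
move=> [fV [fE [sV _ fP _]]] [[x _] cX]; split; first by exists (fV x).
move=> u v; have [a _ <-] := sV u I; have [b _ <-] := sV v I.
by have [s /(walk_image fP) ws] := cX a b; eexists; exact: ws.
Qed.

Section ComponentGraph.
Local Open Scope classical_set_scope.
Variables (n c : nat) (A : 'I_c -> rel 'I_n) (V : atlas n c) (S : {set avert V}).
Hypotheses (A_sym : forall j, symmetric (A j)).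

Definition comp_vert : finType := {v : avert V | v \in S}.

(** An edge is a pair of a color and a set of end points: parallel edges come from
    different atoms. *)
Definition comp_edge_pred (p : 'I_c * {set avert V}) : bool :=
  [exists v in S, exists w in S, atom_adj A p.1 v w && (p.2 == [set v; w]%SET)].
Definition comp_edge : finType := {p : 'I_c * {set avert V} | comp_edge_pred p}.
Definition comp_ends (e : comp_edge) : set comp_vert := [set x | val x \in (val e).2].

Lemma comp_edgeP (e : comp_edge) : exists v w : comp_vert,
  atom_adj A (val e).1 (val v) (val w) /\ (val e).2 = [set val v; val w]%SET.
Proof.
have /exists_inP[v vS /exists_inP[w wS /andP[a /eqP e2]]] := valP e.
by exists (exist (fun v => v \in S) v vS), (exist (fun v => v \in S) w wS).
Qed.

Lemma comp_ends_eq (e : comp_edge) (x y : comp_vert) :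
  comp_ends e = [set x; y] <-> (val e).2 = [set val x; val y]%SET.
Proof.
split=> [E|E]; last first.
  rewrite /comp_ends E; apply/seteqP; split=> z /=; rewrite !inE.
    by case/orP=> /eqP/val_inj->; [left|right].
  by case=> ->; rewrite eqxx ?orbT.
have [v [w [_ e2]]] := comp_edgeP e.
have E2 : comp_ends e = [set v; w].
  rewrite /comp_ends e2; apply/seteqP; split=> z /=; rewrite !inE.
    by case/orP=> /eqP/val_inj->; [left|right].
  by case=> ->; rewrite eqxx ?orbT.
rewrite e2; move: E2; rewrite E => E2.
by case: (set2_eq E2) => -[-> ->] //; rewrite finset.setUC.
Qed.

Lemma comp_endsP (e : comp_edge) : exists v w, comp_ends e = [set v; w].
Proof.
by have [v [w [_ e2]]] := comp_edgeP e; exists v, w; apply/comp_ends_eq.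
Qed.

Definition comp_graph : fingraph := FinGraph comp_endsP.

Lemma comp_edges_card (x y : comp_vert) :
  #|[pred e : comp_edge | `[< comp_ends e = [set x; y] >]]| =
  adj_mult A (val x) (val y).
Proof.
set P := [pred e : comp_edge | _].
have injP : {in P &, injective (fun e : comp_edge => (val e).1)}.
  move=> e e' /asboolP/comp_ends_eq E /asboolP/comp_ends_eq E' e1; apply: val_inj.
  by apply: injective_projections; rewrite // E E'.
rewrite -(card_in_imset injP) /adj_mult -sum1_card big_mkcond /=.
apply: eq_bigr => C _; rewrite -[RHS]/(nat_of_bool _);
  set b := (X in if X then _ else _).
suff -> : b = atom_adj A C (val x) (val y) by case: (atom_adj _ _ _ _).
apply/imsetP/idP => [[e /asboolP/comp_ends_eq E ->]|a].
  have [v [w [a Evw]]] := comp_edgeP e; move: a.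
  by rewrite Evw in E; case: (finset2_eq E) => -[-> ->] //; rewrite atom_adj_sym.
have pe : comp_edge_pred (C, [set val x; val y]%SET).
  apply/exists_inP; exists (val x); first exact: valP.
  by apply/exists_inP; exists (val y); [exact: valP|rewrite a eqxx].
by exists (exist (fun p => comp_edge_pred p) _ pe) => //; apply/asboolP/comp_ends_eq.
Qed.

Lemma charpoly_comp (R : realType) :
  char_poly (adjmx R comp_graph) = minor S (@char_entry R n c A V).
Proof.
pose h (i : 'I_#|comp_vert|) : avert V := val (enum_val i : comp_vert).
rewrite (@minor_sub _ _ _ _ _ h); first last.
- move=> v; apply/idP/existsP => [vS|[i /eqP<-]];
    last exact: (valP (enum_val i : comp_vert)).
  exists (enum_rank (exist (fun v => v \in S) v vS : comp_vert)).
  by rewrite /h enum_rankK.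
- by move=> i j /val_inj/enum_val_inj.
congr (\det _); apply/matrixP=> i j; rewrite !mxE /char_entry /h.
rewrite (inj_eq val_inj) (inj_eq enum_val_inj) mulr_natl; congr (_ - (_%:R)%:P).
exact: comp_edges_card.
Qed.
End ComponentGraph.

Section ComponentCover.
Local Open Scope classical_set_scope.
Variables (n c : nat) (A : 'I_c -> rel 'I_n) (v1 : 'I_n).
Hypotheses (A_sym : forall j, symmetric (A j)) (A_irr : forall j, irreflexive (A j)).
Hypothesis atom_conn : forall j, connected_graph (underline A j).
Variables (V : atlas n c) (v0 : avert V).
Hypothesis v0_ty : aty v0 = v1.
Local Notation X := (additive_product A v1).
Local Notation Y := (vert X).

Definition atlas_rel (v w : avert V) := [exists C, atom_adj A C v w].
Definition component (v : avert V) : {set avert V} :=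
  [set w | connect atlas_rel v w]%SET.
Local Notation S := (component v0).
Local Notation f := (unfold v0).

Lemma atlas_rel_sym : symmetric atlas_rel.
Proof. by move=> v w; apply: eq_existsb => C; rewrite atom_adj_sym. Qed.

Lemma atom_adj_unfold C (y : Y) w : atom_adj A C (f y) w ->
  [/\ A C (vtype y) (aty w), f (vmove C y (aty w)) = w,
    vtype (vmove C y (aty w)) = aty w &
      vadj y (vmove C y (aty w))].
Proof.
move=> /andP[]; rewrite (aty_unfold v0_ty) => a /eqP e.
have /andP[n1 n2] := edge_nonisolated A_sym a.
by split; rewrite ?unfold_move ?vtype_move //; apply: vadj_move.
Qed.

Definition colored_adj C (y z : Y) := A C (vtype y) (vtype z) &&
  (z == vmove C y (vtype z)).

Lemma colored_adj_sym C (y z : Y) : colored_adj C y z -> colored_adj C z y.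
Proof.
move=> /andP[a /eqP e]; have /andP[n1 n2] := edge_nonisolated A_sym a.
by rewrite /colored_adj A_sym a {1}e vmove_move // vmove_id eqxx.
Qed.

Lemma colored_adj_color C C' (y z : Y) : colored_adj C y z -> colored_adj C' y z ->
  C = C'.
Proof.
move=> /andP[a /eqP e] /andP[a' /eqP e'].
by have [] := vmove_inj A_sym A_irr a a' (etrans (esym e) e').
Qed.

Lemma colored_adj_atom C (y z : Y) : colored_adj C y z -> atom_adj A C (f y) (f z).
Proof.
move=> /andP[a /eqP e]; have /andP[n1 n2] := edge_nonisolated A_sym a.
by rewrite /atom_adj !(aty_unfold v0_ty) a {1}e unfold_move // eqxx.
Qed.

Lemma vadj_colored (y z : Y) : vadj y z -> exists C, colored_adj C y z.
Proof. by case/existsP=> C ?; exists C. Qed.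

Lemma unfold_component (y : Y) : f y \in S.
Proof.
have [s] := connX A_sym A_irr atom_conn (rootY A v1) y.
rewrite inE; have : connect atlas_rel v0 (f (rootY A v1)) by exact: connect0.
elim: s (rootY A v1) => [|[e w] s IH] u /= cu; first by move=> <-.
move=> [E ws]; apply: (IH w) => //; apply: connect_trans cu (connect1 _).
have [C /colored_adj_atom a] := vadj_colored (endsX_adj A_sym E).
by apply/existsP; exists C.
Qed.

Lemma unfold_surj w : w \in S -> exists y : Y, f y = w.
Proof.
rewrite inE => /connectP[p vp ->] {w}.
suff step q v : path atlas_rel v q -> (exists y : Y, f y = v) -> exists y : Y,
  f y = last v q.
  by apply: step vp _; exists (rootY A v1).
elim: q v => [|u q IH] v //= /andP[/existsP[C a] uq] [y yv].
apply: IH uq _; rewrite -yv in a.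
by have [_ <- _ _] := atom_adj_unfold a; exists (vmove C y (aty u)).
Qed.

Let fV (y : Y) : comp_vert S := exist (fun v => v \in S) (f y) (unfold_component y).

Let fact (e : edge X) (g : comp_edge A S) := exists y z,
  [/\ colored_adj (val g).1 y z, ends e = [set y; z] & (val g).2 = [set f y; f z]%SET].

(** The edge map sends an edge of [X] to its color and the image of its ends;
    both the color of an edge of [X] and the neighbor reached through a given
    atom and type are unique, whence the local bijection. *)
Lemma comp_covers : covers X (comp_graph A S).
Proof.
have factP e : exists g, fact e g.
  have [y [z [a E]]] := edgeX_ex A_sym e.
  have [C Cyz] := vadj_colored a.
  have pe : comp_edge_pred A S (C, [set f y; f z]%SET).
    apply/exists_inP; exists (f y); first exact: unfold_component.
    apply/exists_inP; exists (f z); first exact: unfold_component.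
    by rewrite colored_adj_atom /=.
  by exists (exist (fun p => comp_edge_pred A S p) _ pe), y, z.
have [fE fEP] := choice factP.
have endsE e : ends (fE e : edge (comp_graph A S)) = fV @` ends e.
  have [y [z [_ E g2]]] := fEP e.
  rewrite E image_setU !image_set1; apply/(comp_ends_eq (fE e) (fV y) (fV z)).
  exact: g2.
have lift_edge C y w : atom_adj A C (f y) w -> exists e,
  ends e y /\ val (fE e) = (C, [set f y; w]%SET).
  move=> a; have [_ fz tz yz] := atom_adj_unfold a; set z := vmove C y _ in fz tz yz.
  have [e E] := edgeX_mk A_sym A_irr yz; exists e; split; first by rewrite E; left.
  have Cyz : colored_adj C y z by rewrite /colored_adj tz eqxx andbT;
    have [] := atom_adj_unfold a.
  have [y' [z' [C' E' g2]]] := fEP e; apply: injective_projections => /=.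
    move: E'; rewrite E => E'; case: (set2_eq E') => -[yy zz].
      by apply: (@colored_adj_color _ _ y z) => //; rewrite yy zz.
    by apply: (@colored_adj_color _ _ y z) => //; rewrite yy zz; apply: colored_adj_sym.
  rewrite g2 -fz; move: E'; rewrite E => E'; case: (set2_eq E') => -[-> ->] //.
  by rewrite finset.setUC.
have edge_at (g : comp_edge A S) y : ends (g : edge (comp_graph A S)) (fV y) ->
    exists2 w, atom_adj A (val g).1 (f y) w & (val g).2 = [set f y; w]%SET.
  rewrite /= /comp_ends /=; have [v [w [a ->]]] := comp_edgeP g.
  rewrite !inE => /orP[/eqP->|/eqP->]; first by exists (val w).
  by exists (val v); [rewrite atom_adj_sym|rewrite finset.setUC].
exists fV, fE; split => //.
- move=> [w wS] _; have [y yw] := unfold_surj wS; exists y => //.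
  by apply: val_inj.
- move=> g _; have [v [w [a g2]]] := comp_edgeP g.
  have [y yv] := unfold_surj (valP v); rewrite -yv in a.
  have [e [_ ee]] := lift_edge _ _ _ a; exists e => //; apply: val_inj.
  by rewrite ee yv -g2; case: (val g).
- move=> y; split.
  + by move=> e /= ey; rewrite -[comp_ends _]/(ends (fE e : edge (comp_graph A S)))
      endsE; exists y.
  + have norm e : ends e y -> exists2 z, colored_adj (val (fE e)).1 y z &
        ends e = [set y; z] /\ (val (fE e)).2 = [set f y; f z]%SET.
      have [y' [z' [C' E' g2]]] := fEP e; rewrite E' => -[->|->]; first by exists z'.
      by exists y'; [apply: colored_adj_sym|rewrite setUC finset.setUC].
    move=> e e' /set_mem /norm[z Cz [E g]] /set_mem /norm[z' Cz' [E' g']] ee.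
    apply: endsX_inj; rewrite E E'; congr [set _; _].
    have fz : f z = f z'.
      move: g'; rewrite -ee g => gg.
      by case: (finset2_eq gg) => -[] // -> ->.
    move: Cz Cz' => /andP[_ /eqP ->] /andP[_ /eqP ->].
    by rewrite -!(aty_unfold v0_ty) fz -ee.
  + move=> g /= gy; have [w a g2] := edge_at g y gy.
    have [e [ey ee]] := lift_edge _ _ _ a; exists e => //; apply: val_inj.
    by rewrite ee -g2; case: (val g).
Qed.

Lemma comp_FinQuo : FinQuo X (comp_graph A S).
Proof.
split; last exact: comp_covers.
apply: covers_connected comp_covers _; split; first by exists (rootY A v1).
exact: connX.
Qed.

End ComponentCover.

(** * Comparison of largest eigenvalues *)

(** For such matrices the expansion of Cramer numerators has only nonnegative
    terms; this is the positivity of inverses of M-matrices. *)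
Lemma cramer_gt0 (K : realDomainType) (W : finType) (M : W -> W -> K) (S : {set W}) :
    (forall T : {set W}, T \subset S -> 0 < minor T M) ->
    (forall v w, v != w -> M v w <= 0) ->
  forall v, v \in S -> 0 < cramer S M (fun=> 1) v.
Proof.
have [m] := ubnP #|S|; elim: m S => // m IH S; rewrite ltnS => cS M0 Mle v vS.
rewrite (cramer_rec _ _ vS) mul1r ltr_wpDr ?M0 ?subD1set //.
rewrite -sumrN sumr_ge0 // => w wS; rewrite -mulNr mulr_ge0 //.
  by rewrite oppr_ge0 Mle //; move: wS; rewrite !inE eq_sym => /andP[].
apply/ltW/IH => //; first by move: cS; rewrite (cardsD1 v S) vS.
by move=> T TS; apply: M0; apply: fintype.subset_trans TS (subD1set _ _).
Qed.

Section Perron.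
Local Open Scope classical_set_scope.
Variables (R : realType) (n c : nat) (A : 'I_c -> rel 'I_n) (v1 : 'I_n).
Hypotheses (A_sym : forall j, symmetric (A j)) (A_irr : forall j, irreflexive (A j)).
Hypothesis atom_conn : forall j, connected_graph (underline A j).
Variables (V : atlas n c).
Local Notation X := (additive_product A v1).
Local Notation Y := (vert X).

Lemma minor_char_entry_signsum (T : {set avert V}) :
  minor T (@char_entry R n c A V) =
    signsum_charpoly R (atom_adj A (V := V)) [::] [ffun=> false] T.
Proof.
apply: eq_minor => v w _ _; rewrite /char_entry /signed_char; congr (_ - _).
rewrite /adj_mult natr_sum raddf_sum; apply: eq_bigr => C _.
by rewrite !ffunE sgb_sqr mulr1 raddfMn.
Qed.

(** The function [h] is the solution of [(y - A) h = 1] on [S], up to a positive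
    factor. *)
Lemma supersolution (S : {set avert V}) (r y : R) : r < y ->
    (forall x, r < x -> 0 < (minor S (@char_entry R n c A V)).[x]) ->
  exists2 h : avert V -> R, (forall v, v \in S -> 0 < h v) &
    forall v, v \in S -> \sum_(p : 'I_c * avert V | (p.2 \in S) &&
      atom_adj A p.1 v p.2) h p.2 <= y * h v.
Proof.
move=> ry S0.
pose M (v w : avert V) : R := (v == w)%:R * y - (adj_mult A v w)%:R.
have ME T : (minor T (@char_entry R n c A V)).[y] = minor T M.
  rewrite -[LHS]/(horner_eval y _) minor_morph; apply: eq_minor => v w _ _.
  by rewrite /= /horner_eval /char_entry hornerD hornerN hornerM hornerX !hornerC
    hornerMn hornerC.
have M0 (T : {set avert V}) : T \subset S -> 0 < minor T M.
  move=> TS; rewrite -ME minor_char_entry_signsum.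
  apply: (signsum_charpoly_gt0_sub (atom_adj_sym A_sym (V := V))
    (atom_adj_irr A_irr (V := V)) TS _ ry).
  by move=> t rt; rewrite -minor_char_entry_signsum S0.
have Mle v w : v != w -> M v w <= 0.
  by move=> /negPf vw; rewrite /M vw mul0r sub0r oppr_le0.
pose h := cramer S M (fun=> 1); exists h; first exact: cramer_gt0.
move=> v vS; have := cramerE M (fun=> 1) vS; rewrite mulr1 -/h => E.
have : 0 < \sum_(w in S) M v w * h w by rewrite E M0.
under eq_bigr => w wS do rewrite /M mulrBl.
rewrite sumrB subr_gt0 => /ltW; congr (_ <= _).
  rewrite -[RHS](pair_big_dep predT (fun C w =>
    (w \in S) && atom_adj A C v w) (fun C w => h w)) /=.
  under eq_bigr do rewrite /adj_mult natr_sum mulr_suml.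
  rewrite exchange_big /=; apply: eq_bigr => C _.
  rewrite big_mkcondr /=; apply: eq_bigr => w wS.
  by case: ifP; rewrite ?mul1r ?mul0r.
rewrite (bigD1 v) //= eqxx mul1r big1 ?addr0 // => w /andP[_ /negPf wv].
by rewrite eq_sym wv !mul0r.
Qed.

Lemma lambda_root (G : fingraph) : 0 < lambda R 1 G ->
  root (char_poly (adjmx R G)) (lambda R 1 G).
Proof.
rewrite /lambda /=; set L := eigenvalues _ => L0.
have : L`_0 \in L.
  apply: mem_nth; rewrite lt0n; apply: contraTneq L0 => /size0nil->.
  by rewrite ltxx.
rewrite {2}/L mem_sort => /flattenP[s /mapP[x xr ->]].
move=> /nseqP[-> _]; move: xr; rewrite in_roots => /andP[] //.
Qed.

(** The function [h] is pulled back to [X] and pushed down to [G] by taking the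
    minimum [k] over the fibers.  As neighbors are in bijection, [A k <= y k]
    holds on [G], and pairing [k] with the absolute values of an eigenvector gives
    the bound. *)
Lemma perron_bound (G : fingraph) (y : R) (S : {set avert V}) (v0 : avert V)
  (h : avert V -> R) :
    covers X G -> aty v0 = v1 -> (forall z : Y, unfold v0 z \in S) ->
    (forall v, v \in S -> 0 < h v) ->
    (forall v, v \in S -> \sum_(p : 'I_c * avert V | (p.2 \in S) &&
      atom_adj A p.1 v p.2) h p.2 <= y * h v) ->
  forall x, root (char_poly (adjmx R G)) x -> x <= y.
Proof.
move=> [fV [fE [sV sE endsE bE]]] v0_ty fS h0 hy x.
rewrite -eigenvalue_root_char => /eigenvalueP[w wx w0].
(* the fibers are infinite, but h takes finitely many values on each of them *)
pose over (i : fvert G) (v : avert V) :=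
  `[< exists2 z : Y, fV z = i & unfold v0 z = v >].
have kP i : exists z : Y, fV z = i /\ forall z', fV z' = i ->
  h (unfold v0 z) <= h (unfold v0 z').
  have [z0 _ z0i] := sV i I.
  have ov0 : over i (unfold v0 z0) by apply/asboolP; exists z0.
  case: (arg_minP h ov0) => v /asboolP[z zi zv] vmin.
  by exists z; split=> // z' z'i; rewrite zv; apply: vmin; apply/asboolP; exists z'.
have [g gP] := choice kP.
pose k i := h (unfold v0 (g i)).
have k0 i : 0 < k i by apply: h0.
have kle z : k (fV z) <= h (unfold v0 z) by have [_] := gP (fV z); apply.
have key i : \sum_(p : fvert G * fedge G | `[< fends p.2 = [set i; p.1] >]) k p.1 <=
  y * k i.
  apply: le_trans (hy _ (fS (g i))).
  have [gi _] := gP i; pose P (p : fvert G * fedge G) :=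
    `[< fends p.2 = [set i; p.1] >].
  have lft0 (p : fvert G * fedge G) : P p -> exists q : edge X * ('I_c * avert V),
      [/\ fE q.1 = p.2, atom_adj A q.2.1 (unfold v0 (g i)) q.2.2,
          ends q.1 = [set g i; vmove q.2.1 (g i) (aty q.2.2)] &
          unfold v0 (vmove q.2.1 (g i) (aty q.2.2)) = q.2.2 /\
          fV (vmove q.2.1 (g i) (aty q.2.2)) = p.1].
    case: p => j e /asboolP /= ee.
    have [_ _ srj] := bE (g i).
    have [d dg de] : [set fE e | e in [set e | ends e (g i)]] e.
      by apply: srj => /=; rewrite gi ee; left.
    have [z [C [Cz dE]]] : exists z C, colored_adj C (g i) z /\ ends d = [set g i; z].
      have [y' [z' [a dE]]] := edgeX_ex A_sym d; have [C Cyz] := vadj_colored a.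
      have {dg} dg : ends d (g i) := dg; rewrite dE in dg *.
      case: dg => ->; first by exists z', C.
      by exists y', C; split; [apply: colored_adj_sym|rewrite setUC].
    have zE : z = vmove C (g i) (vtype z) by case/andP: Cz => _ /eqP.
    exists (d, (C, unfold v0 z)); rewrite /= (aty_unfold v0_ty) -zE; split=> //.
      exact: colored_adj_atom.
    split=> //; have E : fends e = [set fV x | x in ends d] by rewrite -de;
      exact: endsE.
    rewrite ee dE image_setU !image_set1 gi in E.
    by case: (set2_eq E) => -[] // <- ->.
  have [p0 Pp0|noP] := pickP P; last first.
    rewrite big_pred0 // sumr_ge0 // => p /andP[pS _]; exact/ltW/h0.
  have [q0 _] := lft0 p0 Pp0.
  have lft p : exists q : edge X * ('I_c * avert V), P p ->
      [/\ fE q.1 = p.2, atom_adj A q.2.1 (unfold v0 (g i)) q.2.2,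
          ends q.1 = [set g i; vmove q.2.1 (g i) (aty q.2.2)] &
          unfold v0 (vmove q.2.1 (g i) (aty q.2.2)) = q.2.2 /\
          fV (vmove q.2.1 (g i) (aty q.2.2)) = p.1].
    by case: (boolP (P p)) => [/lft0[q qP]|_]; [exists q|exists q0].
  have [q qP] := choice lft.
  apply: (@ler_sum_inj _ _ _ _ _ (fun p => (q p).2)) =>
    [p Pp|p p' Pp Pp' e2|p Pp|p /andP[pS _]].
  - by have [_ a _ [uE _]] := qP p Pp; rewrite a andbT -uE fS.
  - have [e1 _ E1 [_ f1]] := qP p Pp; have [e1' _ E1' [_ f1']] := qP p' Pp'.
    apply: injective_projections; first by rewrite -f1 -f1' e2.
    by rewrite -e1 -e1'; congr (fE _); apply: endsX_inj; rewrite E1 E1' e2.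
  - by have [_ _ _ [uE fE1]] := qP p Pp; rewrite -fE1 -[X in h X]uE kle.
  - exact/ltW/h0.
have keyM j : \sum_i adjmx R G j i * k (enum_val i) <= y * k (enum_val j).
  apply: le_trans (key (enum_val j)).
  rewrite -(pair_big_dep predT (fun a e =>
    `[< fends e = [set enum_val j; a] >]) (fun a e => k a)) /=.
  rewrite [leRHS](reindex (fun i : 'I_#|fvert G| => enum_val i)) /=; last first.
    by apply: onW_bij; exact: enum_val_bij.
  by apply: ler_sum => i _; rewrite mxE sumr_const mulr_natl.
pose N := \sum_i `|w 0 i| * k (enum_val i).
have N0 : 0 < N.
  have [i wi] : exists i, w 0 i != 0.
    apply/existsP; apply: contraNT w0; rewrite negb_exists => /forallP w0.
    by apply/eqP/rowP => i; rewrite mxE; apply/eqP; rewrite -[_ == _]negbK w0.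
  rewrite /N (bigD1 i) //= ltr_pwDl //; first by rewrite mulr_gt0 // normr_gt0.
  by apply: sumr_ge0 => j _; rewrite mulr_ge0 // ltW.
rewrite -(ler_pM2r N0); apply: le_trans (ler_wpM2r (ltW N0) (ler_norm x)) _.
rewrite {1}/N mulr_sumr.
apply: le_trans (_ : \sum_i \sum_j `|w 0 j| * (adjmx R G j i * k (enum_val i)) <= _).
  apply: ler_sum => i _; rewrite mulrA -normrM.
  move/rowP/(_ i): wx; rewrite !mxE => <-.
  under [leRHS]eq_bigr do rewrite mulrA.
  rewrite -mulr_suml; apply: ler_wpM2r; first exact/ltW.
  apply: le_trans (ler_norm_sum _ _ _) _.
  by apply: ler_sum => j _; rewrite normrM mxE [X in _ * X]ger0_norm.
rewrite exchange_big /= /N mulr_sumr; apply: ler_sum => j _.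
by rewrite -mulr_sumr mulrCA ler_wpM2l.
Qed.

End Perron.

(** * Counting the eigenvalues above the spectral radius *)

Section BigRoots.
Variable R : realType.
Implicit Types (p q : {poly R}) (xs : seq R).

(** The roots above [r] are coprime to the factor without such roots. *)
Lemma few_big_roots_size (r : R) m p xs : p != 0 -> few_big_roots r m p ->
  all (fun x => r < x) xs -> \prod_(x <- xs) ('X - x%:P) %| p -> (size xs <= m)%N.
Proof.
move=> p0 [P [Q [pE sP Q0]]] xsr; rewrite pE.
have cop : coprimep (\prod_(x <- xs) ('X - x%:P)) Q.
  elim: xs xsr => [|x xs IH] /=; first by rewrite big_nil coprime1p.
  move=> /andP[rx xsr]; rewrite big_cons coprimepMl IH // andbT.
  by rewrite coprimep_sym coprimep_XsubC /root Q0.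
rewrite Gauss_dvdpl // => /dvdp_leq; rewrite size_prod_XsubC => le.
have P0 : P != 0 by apply: contraNneq p0 => P0; rewrite pE P0 mul0r.
by have := leq_trans (le P0) sP; rewrite ltnS.
Qed.

Lemma prod_mup_dvd p (xs : seq R) : p != 0 -> uniq xs ->
  \prod_(x <- flatten [seq nseq (mup x p) x | x <- xs]) ('X - x%:P) %| p.
Proof.
move=> p0; elim: xs => [|x xs IH] /=; first by rewrite big_nil dvd1p.
move=> /andP[xxs uxs]; rewrite big_cat /= big_nseq -/(iterop _ _ _ _).
have -> : iter (mup x p) (fun q => ('X - x%:P) * q) 1 = ('X - x%:P) ^+ mup x p.
  by elim: (mup x p) => //= k ->; rewrite exprS.
rewrite Gauss_dvdp; first by rewrite -mup_geq // leqnn IH.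
apply: coprimep_expl; rewrite coprimep_sym coprimep_XsubC.
apply/negP; rewrite root_prod_XsubC => /flattenP[s /mapP[y yxs ->]].
by move=> /nseqP[yx _]; rewrite yx yxs in xxs.
Qed.

Lemma eigenvalue_le (r : R) n m (M : 'M[R]_n) p : 0 <= r -> p != 0 ->
  few_big_roots r m p -> char_poly M %| p -> (eigenvalues M)`_m <= r.
Proof.
move=> r0 p0 few Mp; have M0 : char_poly M != 0
  by rewrite monic_neq0 // char_poly_monic.
rewrite leNgt; apply/negP=> big; set L := eigenvalues M in big.
(* beyond the end of the list, the value is the default 0, which is at most r *)
have mL : (m < size L)%N.
  by rewrite ltnNge; apply: contraTN big => /(nth_default 0)->; rewrite -leNgt.
have /few_big_roots_size : all (fun x => r < x) (take m.+1 L).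
  apply/(all_nthP 0) => i; rewrite size_take_min ltn_min => /andP[im iL].
  rewrite nth_take //; apply: lt_le_trans big _.
  have srt : sorted >=%R L.
    by apply: sort_sorted => x y; exact: le_total.
  have tr : transitive (>=%R : rel R) by move=> a b c /= ab bc; exact: le_trans bc ab.
  have rf : reflexive (>=%R : rel R) by move=> a /=.
  by have /= := sorted_leq_nth tr rf 0 srt i m; rewrite !inE; apply.
move=> /(_ _ _ p0 few); rewrite size_takel // ltnn; case/(_ _)/notF.
have dv : \prod_(x <- L) ('X - x%:P) %| char_poly M.
  rewrite (perm_big (flatten
    [seq nseq (mup x (char_poly M)) x | x <- rootsR (char_poly M)])).
    by apply: prod_mup_dvd => //; exact: uniq_roots.
  by rewrite /L /eigenvalues perm_sort.
apply: dvdp_trans (dvdp_trans dv Mp);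
  rewrite -[in X in _ %| X](cat_take_drop m.+1 L) big_cat.
by apply: dvdp_mulr.
Qed.
End BigRoots.

Section Final.
Variables (R : realType) (n c : nat) (A : 'I_c -> rel 'I_n) (v1 : 'I_n).
Hypotheses (A_sym : forall j, symmetric (A j)) (A_irr : forall j, irreflexive (A j)).
Hypothesis sum_conn : connected_graph (sum_graph A).
Hypothesis atom_conn : forall j, connected_graph (underline A j).
Local Notation X := (additive_product A v1).
Variable r : R.
Hypothesis rhoE : rho R X = r%:E.
Hypothesis r0 : 0 <= r.
Hypothesis r_chi : r < chi R X.

Section OneAtlas.
Variable V : atlas n c.
Local Notation e := (atlas_rel A (V := V)).

(** Otherwise all minors of [y - A] on the component are positive for [y > r], and
    [perron_bound] for [y] between [r] and [chi X] contradicts the definition of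
    [chi X]. *)
Lemma component_big_root (v0 : avert V) : aty v0 = v1 ->
  exists2 x, r < x & root (minor (component A v0) (@char_entry R n c A V)) x.
Proof.
move=> v0t; apply: contrapT => no.
have S0 x : r < x -> 0 < (minor (component A v0) (@char_entry R n c A V)).[x].
  apply: lead_coef_noroot_gt0.
    by rewrite minor_char_entry (monicP (char_poly_monic _)) ltr01.
  by move=> t rt; apply/negP => rt0; apply: no; exists t.
have [G GX chiE] : exists2 G, FinQuo X G & chi R X = lambda R 1 G.
  have : 0 < chi R X by apply: le_lt_trans r_chi.
  rewrite /chi; case: xgetP => [_ _ [G GX ->] _|_]; first by exists G.
  by rewrite ltxx.
pose y := (r + chi R X) / 2.
have [h h0 hy] := @supersolution R n c A A_sym A_irr V _ r y (midf_lt r_chi).1 S0.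
have chi0 : 0 < lambda R 1 G by rewrite -chiE (le_lt_trans r0).
have [_ cov] := GX.
have := perron_bound A_sym cov v0t (unfold_component A_sym A_irr atom_conn v0t) h0 hy
  (lambda_root chi0).
by rewrite -chiE leNgt midf_lt.
Qed.

Lemma root_block v : exists2 v0, aty v0 = v1 &
  [set w | fingraph.root e w == fingraph.root e v]%SET = component A v0.
Proof.
have [v0 v0t [y yE]] := unfold_reach v1 A_sym sum_conn v; exists v0 => //.
have csym : connect_sym e by apply: sym_connect_sym; exact: atlas_rel_sym.
have cv : connect e v0 v.
  by have := unfold_component A_sym A_irr atom_conn v0t y; rewrite yE inE.
apply/finset.setP => w; rewrite !inE root_connect // csym.
by rewrite (same_connect csym cv).
Qed.

Lemma adj_mult_root v w : fingraph.root e v != fingraph.root e w ->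
  adj_mult A v w = 0%N.
Proof.
move=> vw; apply: big1 => C _; case: (boolP (atom_adj A C v w)) => // a.
case/negP: vw; rewrite root_connect; last by apply: sym_connect_sym;
  exact: atlas_rel_sym.
by apply: connect1; apply/existsP; exists C.
Qed.

Lemma minor_blocks (rs : seq (avert V)) : uniq rs ->
  minor [set w | fingraph.root e w \in rs]%SET (@char_entry R n c A V) =
  \prod_(u <- rs) minor [set w | fingraph.root e w == u]%SET (@char_entry R n c A V).
Proof.
elim: rs => [|u rs IH] /=.
  by rewrite big_nil (_ : [set w | _]%SET = finset.set0) ?minor0 //;
    apply/finset.setP => w; rewrite !inE.
move=> /andP[urs uq]; rewrite big_cons -IH // -minorU.
- by congr minor; apply/finset.setP => w; rewrite !inE.
- rewrite -setI_eq0; apply/eqP/finset.setP => w; rewrite !inE.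
  by apply/negP=> /andP[/eqP->]; apply/negP.
- move=> a b; rewrite !inE => /eqP ra rb.
  have ab : fingraph.root e a != fingraph.root e b.
    by apply: contraNneq urs; rewrite ra => ->.
  have nab : a != b by apply: contraNneq ab => ->.
  rewrite /char_entry (negPf nab) [b == a]eq_sym (negPf nab) !adj_mult_root //
    1?eq_sym //.
  by rewrite mul0r sub0r polyC0 oppr0.
Qed.

Lemma atlas_charpoly_blocks : atlas_charpoly R A V =
  \prod_(u <- enum (fingraph.roots e)) minor [set w | fingraph.root e w == u]%SET
    (@char_entry R n c A V).
Proof.
rewrite -minor_blocks ?enum_uniq // atlas_charpoly_minor; congr minor.
apply/finset.setP => w; rewrite !inE mem_enum; symmetry.
by apply: roots_root; apply: sym_connect_sym; exact: atlas_rel_sym.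
Qed.

(** Different components contribute different factors of the characteristic
    polynomial, each with a root above [r]. *)
Lemma few_components : few_big_roots r n (atlas_charpoly R A V) ->
  (#|fingraph.roots e| <= n)%N.
Proof.
move=> few; have p0 : atlas_charpoly R A V != 0.
  by rewrite -size_poly_gt0 size_atlas_charpoly.
have big u : exists x, u \in fingraph.roots e ->
  r < x /\ 'X - x%:P %| minor [set w | fingraph.root e w == u]%SET
    (@char_entry R n c A V).
  case: (boolP (u \in fingraph.roots e)) => [ur|_]; last by exists 0.
  have [v0 v0t E] := root_block u; rewrite (eqP ur) in E.
  have [x rx rtx] := component_big_root v0t; exists x => _.
  by rewrite E dvdp_XsubCl.
have [f fP] := choice big.
rewrite cardE -(size_map f); apply: few_big_roots_size p0 few _ _.
  by apply/allP=> _ /mapP[u ur ->]; rewrite mem_enum in ur; have [] := fP u ur.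
rewrite big_map atlas_charpoly_blocks.
have : {subset enum (fingraph.roots e) <= fingraph.roots e} by move=> u;
  rewrite mem_enum.
elim: (enum _) => [|u us IH] us_r; first by rewrite !big_nil.
rewrite !big_cons; apply: dvdp_mul; last by apply: IH => w wu;
  rewrite us_r ?inE ?wu ?orbT.
by have [] := fP u (us_r u (mem_head _ _)).
Qed.

Lemma big_component m : few_big_roots r n (atlas_charpoly R A V) ->
  (n * m <= #|avert V|)%N ->
    (0 < n)%N -> (0 < m)%N ->
  exists2 v0 : avert V, aty v0 = v1 & (m <= #|component A v0|)%N.
Proof.
move=> few nm n0 m0; apply: contrapT => no.
have small u : u \in fingraph.roots e ->
  (#|[set w | fingraph.root e w == u]%SET| < m)%N.
  move=> ur; have [v0 v0t E] := root_block u; rewrite (eqP ur) in E.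
  by rewrite E ltnNge; apply/negP => mv; apply: no; exists v0.
have cV : #|avert V| = (\sum_(u in fingraph.roots e)
  #|[set w | fingraph.root e w == u]%SET|)%N.
  rewrite -sum1_card (partition_big (fingraph.root e) (mem (fingraph.roots e))) /=;
    last first.
    by move=> w _; apply: roots_root; apply: sym_connect_sym; exact: atlas_rel_sym.
  by apply: eq_bigr => u _; rewrite -sum1_card; apply: eq_bigl => w; rewrite inE.
have [u0 u0r] : exists u0, u0 \in fingraph.roots e.
  have /card_gt0P[v _] : (0 < #|avert V|)%N.
    by apply: leq_trans nm; rewrite muln_gt0 n0.
  by exists (fingraph.root e v); apply: roots_root; apply: sym_connect_sym;
    exact: atlas_rel_sym.
case: m nm small m0 {no} => [//|m] nm small _.
have : (#|avert V| <= #|fingraph.roots e| * m)%N.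
  by rewrite cV -sum_nat_const; apply: leq_sum => u ur; have := small u ur.
move=> le1; have le2 : (#|fingraph.roots e| * m <= n * m)%N
  by rewrite leq_mul2r few_components ?orbT.
by have := leq_trans nm (leq_trans le1 le2); rewrite leq_mul2l ltnn orbF eqn0Ngt n0.
Qed.

Lemma good_component (v0 : avert V) : aty v0 = v1 ->
  few_big_roots r n (atlas_charpoly R A V) ->
  FinQuo X (comp_graph A (component A v0)) /\
  lambda R n.+1 (comp_graph A (component A v0)) <= r.
Proof.
move=> v0t few; split; first exact: (comp_FinQuo A_sym A_irr atom_conn).
have p0 : atlas_charpoly R A V != 0 by rewrite -size_poly_gt0 size_atlas_charpoly.
apply: (eigenvalue_le r0 p0 few); rewrite (charpoly_comp _ A_sym) atlas_charpoly_blocks.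
have csym : connect_sym e by apply: sym_connect_sym; exact: atlas_rel_sym.
have -> : component A v0 = [set w | fingraph.root e w == fingraph.root e v0]%SET.
  by apply/finset.setP => w; rewrite !inE root_connect // csym.
rewrite (bigD1_seq (fingraph.root e v0)) ?enum_uniq //=; first exact: dvdp_mulr.
by rewrite mem_enum; exact: roots_root.
Qed.
End OneAtlas.

Theorem quasi_ramanujan_n : (0 < n)%N -> quasi_ramanujan R n X.
Proof.
move=> n0.
pose good (G : fingraph) :=
  [/\ FinQuo X G, (n.+1 <= #|fvert G|)%N & ((lambda R n.+1 G)%:E <= rho R X)%E].
(* arbitrarily large good quotients; strictly increasing sizes are then chosen,
   which excludes isomorphisms *)
have ex N : exists G, good G /\ (N <= #|fvert G|)%N.
  have [V [cV few]] := tower A_sym A_irr sum_conn atom_conn rhoE (n.+1 + N).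
  have [||v0 v0t big] := @big_component V (2 ^ (n.+1 + N)) few _ n0.
  - by rewrite cV.
  - by rewrite expn_gt0.
  have [GX lam] := good_component v0t few.
  have le : (n.+1 + N <= #|fvert (comp_graph A (component A v0))|)%N.
    rewrite /= card_sig; apply: leq_trans (ltnW (ltn_expl _ _)) big; by [].
  exists (comp_graph A (component A v0)); split.
    by split=> //; [apply: leq_trans le; rewrite leq_addr|rewrite rhoE lee_fin].
  by apply: leq_trans le; rewrite leq_addl.
have [g gP] := choice ex.
pose G := fix G i := if i is i'.+1 then g #|fvert (G i')|.+1 else g 0%N.
have Ggood i : good (G i) by case: i => [|i]; [exact: (gP 0%N).1|exact: (gP _).1].
have Glt i : (#|fvert (G i)| < #|fvert (G i.+1)|)%N by have [_] := gP #|fvert (G i)|.+1.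
have Gmono i j : (i < j)%N -> (#|fvert (G i)| < #|fvert (G j)|)%N.
  elim: j => // j IH; rewrite ltnS leq_eqVlt => /predU1P[->|/IH lt]; first exact: Glt.
  exact: ltn_trans lt (Glt j).
exists G; split; first exact: Ggood.
move=> i j ij [fV [fE [bV _ _]]].
have cij : #|fvert (G i)| = #|fvert (G j)| by exact: bij_eq_card bV.
case: (ltngtP i j) ij => // [/Gmono|/Gmono] + _; by rewrite cij ltnn.
Qed.

End Final.

Theorem theorem2p22 (R : realType) (n c : nat) (A : 'I_c -> rel 'I_n)
    (v1 : 'I_n)
    (A_sym : forall j, symmetric (A j))
    (A_irr : forall j, irreflexive (A j))
    (sum_conn : connected_graph (sum_graph A))
    (atom_conn : forall j, connected_graph (underline A j))
    (chi_gt_rho : (rho R (additive_product A v1)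
                   < (chi R (additive_product A v1))%:E)%E) :
  exists k : nat, (1 <= k)%N /\ quasi_ramanujan R k (additive_product A v1).
Proof.
have n0 : (0 < n)%N by apply: leq_ltn_trans (ltn_ord v1).
exists n; split=> //; have := rho_ge0 A v1 R.
case E : (rho R (additive_product A v1)) chi_gt_rho => [r| |] //.
rewrite lte_fin lee_fin => r_chi r0.
exact: (quasi_ramanujan_n A_sym A_irr sum_conn atom_conn E r0 r_chi n0).
Qed.
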